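(* Let $K$ be an algebraically closed field of characteristic zero and let $sl_2^c$ be the color Lie algebra over $K$ described in the context. Let $n\ge 1$ be an integer. If $n$ is even, then $sl_2^c$ has, up to isomorphism, exactly four simple representations of dimension $n$, namely the pairwise non-isomorphic simple representations $V_\alpha^n$ with $\alpha\in\{1,-1\}\times\{1,-1\}$. If $n$ is odd, then $sl_2^c$ has, up to isomorphism, exactly five simple representations of dimension $n$, namely the pairwise non-isomorphic simple representations $V_\alpha^n$ with $\alpha\in\{1,-1\}\times\{1,-1\}$, and $W^n$.
   Context: Let $G=\mathbb{Z}_2\times\mathbb{Z}_2$ and $\varepsilon((\alpha_1,\alpha_2),(\beta_1,\beta_2))=(-1)^{\alpha_1\beta_2-\alpha_2\beta_1}$. The color Lie algebra $sl_2^c$ is the $G$-graded $\varepsilon$-Lie algebra with homogeneous basis $a_1,a_2,a_3$ of degrees $|a_1|=(1,0)$, $|a_2|=(0,1)$, $|a_3|=(1,1)$ and bracket $\langle a_1,a_2\rangle=a_3$, $\langle a_2,a_3\rangle=a_1$, $\langle a_3,a_1\rangle=a_2$ (with $\langle x,y\rangle=-\varepsilon(|x|,|y|)\langle y,x\rangle$ for homogeneous $x,y$). A representation of $sl_2^c$ is a $K$-vector space $V$ with a linear map $\rho:sl_2^c\to \mathrm{End}_K(V)$ such that $\rho(\langle x,y\rangle)=\rho(x)\rho(y)-\varepsilon(|x|,|y|)\rho(y)\rho(x)$ for homogeneous $x,y$; representations are not required to be graded. Equivalently, it is a left module over the universal enveloping algebra $\mathcal{U}(sl_2^c)$, the associative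 unital $K$-algebra generated by $a_1,a_2,a_3$ with relations $a_1a_2+a_2a_1=a_3$, $a_2a_3+a_3a_2=a_1$, $a_3a_1+a_1a_3=a_2$. $V_\alpha^n$: for $n\ge1$ and $\alpha=(\alpha_1,\alpha_2)$ with $\alpha_1,\alpha_2\in\{1,-1\}$, the $n$-dimensional representation with basis $e_1,\dots,e_n$ and (with $e_0=0$) $a_1.e_j=\alpha_1\frac{(-1)^{j-1}}{2}\big((2n-j)e_{j+1}-(j-1)e_{j-1}\big)$ for $1\le j\le n-1$; $a_1.e_n=\alpha_1\frac{(-1)^{n-1}}{2}\big(\alpha_2 n e_n-(n-1)e_{n-1}\big)$; $a_2.e_j=-\frac12\big((2n-j)e_{j+1}+(j-1)e_{j-1}\big)$ for $1\le j\le n-1$; $a_2.e_n=-\frac12\big(\alpha_2 n e_n+(n-1)e_{n-1}\big)$; $a_3.e_j=\alpha_1\frac{(-1)^j}{2}(2n-2j+1)e_j$ for $1\le j\le n$. $W^n$: for $n$ odd, the $n$-dimensional representation with basis $e_1,\dots,e_n$ and, for all $1\le j\le n$ (with $e_0=e_{n+1}=0$), $a_1.e_j=\frac{(-1)^{j-1}}{2}\big((n-j)e_{j+1}-(j-1)e_{j-1}\big)$; $a_2.e_j=-\frac12\big((n-j)e_{j+1}+(j-1)e_{j-1}\big)$; $a_3.e_j=\frac{(-1)^j}{2}(n-2j+1)e_j$. *)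

(* Defs.v *)
From HB Require Import structures.
From mathcomp Require Import all_boot all_order all_algebra.
From mathcomp Require Import ring.

Set Implicit Arguments.
Unset Strict Implicit.
Unset Printing Implicit Defensive.

Import GRing.Theory.
Local Open Scope ring_scope.

Definition commutation_factor (G : zmodType) (K : fieldType)
    (eps : G -> G -> K) : Prop :=
  [/\ forall a b, eps a b * eps b a = 1,
      forall a b c, eps a (b + c) = eps a b * eps a c
    & forall a b c, eps (a + b) c = eps a c * eps b c].

Record color_lie (G : finZmodType) (K : fieldType) := ColorLie {
  cl_space :> vectType K;
  cl_eps : G -> G -> K;
  cl_hom : G -> {vspace cl_space};
  cl_br : cl_space -> cl_space -> cl_space;
  cl_epsP : commutation_factor cl_eps;
  cl_direct : directv (\sum_g cl_hom g);
  cl_full : (\sum_g cl_hom g = fullv)%VS;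
  cl_linl : forall y, linear (cl_br^~ y);
  cl_linr : forall x, linear (cl_br x);
  cl_graded : forall g h x y, x \in cl_hom g -> y \in cl_hom h ->
    cl_br x y \in cl_hom (g + h);
  cl_skew : forall g h x y, x \in cl_hom g -> y \in cl_hom h ->
    cl_br x y = - (cl_eps g h *: cl_br y x);
  cl_jacobi : forall g h k x y z,
    x \in cl_hom g -> y \in cl_hom h -> z \in cl_hom k ->
    cl_eps k g *: cl_br x (cl_br y z) + cl_eps g h *: cl_br y (cl_br z x)
      + cl_eps h k *: cl_br z (cl_br x y) = 0 }.

(* Finite-dimensional representations, not required to be graded. *)
Section Representations.
Context {G : finZmodType} {K : fieldType} {L : color_lie G K}.

Definition is_rep (V : vectType K) (rho : 'Hom(L, 'End(V))) : Prop :=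
  forall (g h : G) (x y : L), x \in cl_hom L g -> y \in cl_hom L h ->
    rho (cl_br x y)
      = (rho x \o rho y)%VF - cl_eps L g h *: (rho y \o rho x)%VF.

Definition simple_rep (V : vectType K) (rho : 'Hom(L, 'End(V))) : Prop :=
  [/\ is_rep rho,
      \dim {:V} != 0
    & forall U : {vspace V}, (forall x : L, (rho x @: U <= U)%VS) ->
        U = 0%VS \/ U = fullv].

Definition rep_iso (V W : vectType K)
    (rho : 'Hom(L, 'End(V))) (sigma : 'Hom(L, 'End(W))) : Prop :=
  exists2 f : 'Hom(V, W), bijective f
    & forall (x : L) (v : V), f (rho x v) = sigma x (f v).

Definition exactly_simple_reps (n k : nat)
    (s : k.-tuple 'Hom(L, 'End('rV[K]_n))) : Prop :=
  [/\ forall i : 'I_k, simple_rep (tnth s i),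
      forall i j : 'I_k, i != j -> ~ rep_iso (tnth s i) (tnth s j)
    & forall (V : vectType K) (rho : 'Hom(L, 'End(V))),
        \dim {:V} = n -> simple_rep rho ->
        exists i : 'I_k, rep_iso rho (tnth s i)].

End Representations.

Definition linext (K : fieldType) (U : vectType K) (m : nat) (f : 'I_m -> U) :
    'Hom('rV[K]_m, U) :=
  linfun (fun x : 'rV[K]_m => \sum_i x 0 i *: f i).

Lemma linextE (K : fieldType) (U : vectType K) (m : nat) (f : 'I_m -> U) x :
  linext f x = \sum_i x 0 i *: f i.
Proof.
pose h (x : 'rV[K]_m) := \sum_i x 0 i *: f i.
have hlin : linear h.
  move=> c u v; rewrite /h scaler_sumr -big_split /=; apply: eq_bigr => i _.
  by rewrite !mxE scalerDl scalerA.
pose hL := GRing.isLinear.Build K 'rV[K]_m U _ h hlin.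
pose H : {linear 'rV[K]_m -> U} := HB.pack h hL.
exact: (lfunE H x).
Qed.

Lemma linext_delta (K : fieldType) (U : vectType K) (m : nat)
    (f : 'I_m -> U) i :
  linext f (delta_mx 0 i) = f i.
Proof.
rewrite linextE (bigD1 i) //= big1 ?addr0 => [|j /negPf nji].
  by rewrite mxE !eqxx scale1r.
by rewrite mxE nji andbF scale0r.
Qed.

Definition Klein : Type := ('Z_2 * 'Z_2)%type.
HB.instance Definition _ := Finite.on Klein.
HB.instance Definition _ := GRing.Zmodule.on Klein.

Section Sl2c.
Context (K : fieldType).

(* The exponent is computed in 'Z_2. *)
Definition sl2c_eps (a b : Klein) : K := (-1) ^+ (a.1 * b.2 - a.2 * b.1 : 'Z_2)%R.

Definition sl2c_a (i : 'I_3) : 'rV[K]_3 := delta_mx 0 i.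

Definition sl2c_deg (i : 'I_3) : Klein :=
  tnth [tuple (1, 0); (0, 1); (1, 1)] i.

Definition sl2c_hom (g : Klein) : {vspace 'rV[K]_3} :=
  (\sum_(i < 3 | sl2c_deg i == g) <[sl2c_a i]>)%VS.

(* Since eps (deg i) (deg j) = -1 for i != j, the color skew-symmetry makes the
   bracket symmetric on distinct basis vectors. *)
Definition sl2c_br (x y : 'rV[K]_3) : 'rV[K]_3 :=
    (x 0 0 * y 0 1 + x 0 1 * y 0 0) *: sl2c_a 2%:R
  + (x 0 1 * y 0 2%:R + x 0 2%:R * y 0 1) *: sl2c_a 0
  + (x 0 2%:R * y 0 0 + x 0 0 * y 0 2%:R) *: sl2c_a 1.

Lemma sl2c_br12 : sl2c_br (sl2c_a 0) (sl2c_a 1) = sl2c_a 2%:R.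
Proof.
by rewrite /sl2c_br !mxE /= !(mul0r, mulr0, mulr1, addr0, scale0r, scale1r).
Qed.

Lemma sl2c_br23 : sl2c_br (sl2c_a 1) (sl2c_a 2%:R) = sl2c_a 0.
Proof.
by rewrite /sl2c_br !mxE /= !(mul0r, mulr0, mulr1, addr0, add0r, scale0r, scale1r).
Qed.

Lemma sl2c_br31 : sl2c_br (sl2c_a 2%:R) (sl2c_a 0) = sl2c_a 1.
Proof.
by rewrite /sl2c_br !mxE /= !(mul0r, mulr0, mulr1, addr0, add0r, scale0r, scale1r).
Qed.

Lemma mem_sl2c_hom g (x : 'rV[K]_3) :
  (x \in sl2c_hom g) = [forall i, (sl2c_deg i != g) ==> (x 0 i == 0)].
Proof.
apply/idP/forallP => [/memv_sumP[v vP ->] i | x0].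
  apply/implyP => neg; rewrite summxE big1 // => j /eqP dj.
  have /vlineP[c ->] : v j \in <[sl2c_a j]>%VS by apply: vP; apply/eqP.
  rewrite !mxE eqxx /=; case: eqP => [eij|_]; last by rewrite mulr0.
  by move: neg; rewrite eij dj eqxx.
rewrite [x]row_sum_delta (bigID (fun i => sl2c_deg i == g)) /=.
rewrite [X in _ + X]big1 => [|i ni]; last first.
  by have /implyP/(_ ni)/eqP-> := x0 i; rewrite scale0r.
rewrite addr0; apply: memv_sumr => i _.
by rewrite memvZ // memv_line.
Qed.

Lemma sl2c_epsE (a b : Klein) :
  sl2c_eps a b = (-1) ^+ (a.1 * b.2 + a.2 * b.1)%N.
Proof.
rewrite /sl2c_eps -signr_odd -[RHS]signr_odd.
by case: a b => [[[|[|//]] ?] [[|[|//]] ?]] [[[|[|//]] ?] [[|[|//]] ?]].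
Qed.

Lemma sl2c_epsP : commutation_factor sl2c_eps.
Proof.
have sgnE (m p : nat) : odd m = odd p -> (-1) ^+ m = (-1) ^+ p :> K.
  by move=> e; rewrite -(signr_odd K m) e signr_odd.
split=> [[a1 a2] [b1 b2]|[a1 a2] [b1 b2] [c1 c2]|[a1 a2] [b1 b2] [c1 c2]];
  rewrite !sl2c_epsE -exprD.
- rewrite -(expr0 (-1)); apply: sgnE.
  by case: a1 a2 b1 b2 => [[|[|//]] ?] [[|[|//]] ?] [[|[|//]] ?] [[|[|//]] ?].
- apply: sgnE.
  by case: a1 a2 b1 b2 c1 c2 => [[|[|//]] ?] [[|[|//]] ?] [[|[|//]] ?]
    [[|[|//]] ?] [[|[|//]] ?] [[|[|//]] ?].
- apply: sgnE.
  by case: a1 a2 b1 b2 c1 c2 => [[|[|//]] ?] [[|[|//]] ?] [[|[|//]] ?]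
    [[|[|//]] ?] [[|[|//]] ?] [[|[|//]] ?].
Qed.

Lemma sl2c_indep (u : Klein -> 'rV[K]_3) :
  (forall g, true -> u g \in sl2c_hom g) -> \sum_g u g = 0 ->
  forall g, true -> u g = 0.
Proof.
move=> uP u0 g _.
apply/rowP=> i; rewrite mxE; have [->|ng] := eqVneq g (sl2c_deg i); last first.
  have := uP g isT; rewrite mem_sl2c_hom => /forallP/(_ i)/implyP.
  by rewrite eq_sym => /(_ ng)/eqP.
have /rowP/(_ i) := u0; rewrite summxE mxE (bigD1 (sl2c_deg i)) //= big1 ?addr0 //.
move=> h nh; have := uP h isT; rewrite mem_sl2c_hom => /forallP/(_ i)/implyP.
by rewrite eq_sym => /(_ nh)/eqP.
Qed.

Lemma sl2c_full : (\sum_g sl2c_hom g = fullv)%VS.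
Proof.
apply/vspaceP => x; rewrite memvf [x]row_sum_delta; apply: memv_suml => i _.
apply: memvZ; apply: (subvP (sumv_sup (sl2c_deg i) _ (subvv _))) => //.
rewrite mem_sl2c_hom; apply/forallP => j; apply/implyP => nj.
by rewrite mxE eqxx /=; case: (eqVneq j i) nj => [->|_ _]; rewrite ?eqxx.
Qed.

Lemma row3P (x y : 'rV[K]_3) :
  x 0 0 = y 0 0 -> x 0 1 = y 0 1 -> x 0 2%:R = y 0 2%:R -> x = y.
Proof.
move=> e0 e1 e2; apply/rowP => -[[|[|[|//]]] p].
- by rewrite (_ : Ordinal p = 0) //; apply: val_inj.
- by rewrite (_ : Ordinal p = 1) //; apply: val_inj.
- by rewrite (_ : Ordinal p = 2%:R) //; apply: val_inj.
Qed.

Lemma sl2c_brE x y :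
  (sl2c_br x y 0 0 = x 0 1 * y 0 2%:R + x 0 2%:R * y 0 1)
  * (sl2c_br x y 0 1 = x 0 2%:R * y 0 0 + x 0 0 * y 0 2%:R)
  * (sl2c_br x y 0 2%:R = x 0 0 * y 0 1 + x 0 1 * y 0 0).
Proof.
by rewrite /sl2c_br !mxE /= !(mulr0, mulr1, addr0, add0r).
Qed.

Lemma sl2c_linr x : linear (sl2c_br x).
Proof.
by move=> c u v; apply: row3P; rewrite !(sl2c_brE, mxE); ring.
Qed.

Lemma sl2c_linl y : linear (sl2c_br^~ y).
Proof.
by move=> c u v; apply: row3P; rewrite !(sl2c_brE, mxE); ring.
Qed.

Lemma sl2c_homP g (x : 'rV[K]_3) : x \in sl2c_hom g ->
  [\/ x = 0, g = (1, 0) /\ exists c, x = c *: sl2c_a 0,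
      g = (0, 1) /\ exists c, x = c *: sl2c_a 1
    | g = (1, 1) /\ exists c, x = c *: sl2c_a 2%:R].
Proof.
rewrite mem_sl2c_hom => /forallP H.
have H0 := H 0; have H1 := H 1; have H2 := H 2%:R; move: H0 H1 H2.
rewrite /sl2c_deg /tnth /=.
case: (eqVneq g (1, 0)) => [-> /= _ /eqP x1 /eqP x2|n0].
  by constructor 2; split=> //; exists (x 0 0); apply: row3P;
    rewrite !mxE ?x1 ?x2 /= ?mulr0 ?mulr1.
case: (eqVneq g (0, 1)) => [-> /= /eqP x1 _ /eqP x2|n1].
  by constructor 3; split=> //; exists (x 0 1); apply: row3P;
    rewrite !mxE ?x1 ?x2 /= ?mulr0 ?mulr1.
case: (eqVneq g (1, 1)) => [-> /= /eqP x1 /eqP x2 _|n2].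
  by constructor 4; split=> //; exists (x 0 2%:R); apply: row3P;
    rewrite !mxE ?x1 ?x2 /= ?mulr0 ?mulr1.
move=> _ _ _; constructor 1; apply: row3P; rewrite mxE; apply/eqP.
- by apply: (implyP (H 0)); rewrite eq_sym; exact: n0.
- by apply: (implyP (H 1)); rewrite eq_sym; exact: n1.
- by apply: (implyP (H 2%:R)); rewrite eq_sym; exact: n2.
Qed.

Lemma sl2c_graded g h x y : x \in sl2c_hom g -> y \in sl2c_hom h ->
  sl2c_br x y \in sl2c_hom (g + h).
Proof.
move=> xg yh; suff: forall i, sl2c_deg i != g + h -> sl2c_br x y 0 i == 0.
  by move=> H; rewrite mem_sl2c_hom; apply/forallP=> i; apply/implyP/H.
move=> i ni; case/sl2c_homP: xg yh ni =>
  [->|[-> [c ->]]|[-> [c ->]]|[-> [c ->]]] /sl2c_homP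
  [->|[-> [d ->]]|[-> [d ->]]|[-> [d ->]]];
  rewrite /sl2c_br !mxE /= !(mul0r, mulr0, mulr1, addr0, add0r, eqxx) //;
  case: i => [[|[|[|//]]] p] //=; rewrite ?mulr0 ?addr0 ?eqxx //.
Qed.

Lemma sl2c_skew g h x y : x \in sl2c_hom g -> y \in sl2c_hom h ->
  sl2c_br x y = - (sl2c_eps g h *: sl2c_br y x).
Proof.
move=> /sl2c_homP[->|[-> [c ->]]|[-> [c ->]]|[-> [c ->]]] /sl2c_homP
  [->|[-> [d ->]]|[-> [d ->]]|[-> [d ->]]];
apply: row3P; rewrite !(sl2c_brE, mxE) /sl2c_eps /= ?expr0 ?expr1; ring.
Qed.

Lemma sl2c_br_scale c d x y :
  sl2c_br (c *: x) (d *: y) = (c * d) *: sl2c_br x y.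
Proof. by apply: row3P; rewrite !(sl2c_brE, mxE); ring. Qed.

Lemma sl2c_br0 x : (sl2c_br x 0 = 0) * (sl2c_br 0 x = 0).
Proof. by split; apply: row3P; rewrite !(sl2c_brE, mxE); ring. Qed.

Lemma sl2c_br_diag i : sl2c_br (sl2c_a i) (sl2c_a i) = 0.
Proof.
by case: i => [[|[|[|//]]] p]; apply: row3P; rewrite !(sl2c_brE, mxE) /=; ring.
Qed.

Lemma sl2c_brC x y : sl2c_br x y = sl2c_br y x.
Proof. by apply: row3P; rewrite !(sl2c_brE, mxE); ring. Qed.

Lemma sl2c_jacobi g h k x y z :
  x \in sl2c_hom g -> y \in sl2c_hom h -> z \in sl2c_hom k ->
  sl2c_eps k g *: sl2c_br x (sl2c_br y z)
    + sl2c_eps g h *: sl2c_br y (sl2c_br z x)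
    + sl2c_eps h k *: sl2c_br z (sl2c_br x y) = 0.
Proof.
pose br21 := etrans (sl2c_brC _ _) sl2c_br12.
pose br32 := etrans (sl2c_brC _ _) sl2c_br23.
pose br13 := etrans (sl2c_brC _ _) sl2c_br31.
pose tbl := (sl2c_br_diag, sl2c_br12, sl2c_br23, sl2c_br31, br21, br32, br13).
move=> /sl2c_homP[->|[-> [c ->]]|[-> [c ->]]|[-> [c ->]]] /sl2c_homP
  [->|[-> [d ->]]|[-> [d ->]]|[-> [d ->]]] /sl2c_homP
  [->|[-> [e ->]]|[-> [e ->]]|[-> [e ->]]];
rewrite ?(sl2c_br0, sl2c_br_scale, tbl, scaler0, addr0, add0r) //;
rewrite !scalerA -!scalerDl /sl2c_eps /= ?expr0 ?expr1;
by match goal with |- ?a *: _ = 0 => rewrite (_ : a = 0) ?scale0r //; ring end.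
Qed.

Definition sl2c : color_lie Klein K :=
  ColorLie sl2c_epsP (introT directv_sum_independent sl2c_indep) sl2c_full sl2c_linl sl2c_linr
    sl2c_graded sl2c_skew sl2c_jacobi.

End Sl2c.

Section Models.
Context {K : fieldType}.

(* 1-based; e_ 0 and e_ n.+1 are the zero vector. *)
Definition e_ (n j : nat) : 'rV[K]_n := \row_(i < n) (i.+1 == j)%:R.

(* The action of a_1, a_2, a_3 on e_j, for 1 <= j <= n. *)
Definition V_act1 (n : nat) (alpha : K * K) (j : nat) : 'rV[K]_n :=
  (alpha.1 * ((-1) ^+ j.-1 / 2%:R)) *:
    ((if (j < n)%N then (2%:R * n%:R - j%:R) *: e_ n j.+1
      else (alpha.2 * n%:R) *: e_ n n)
     - (j%:R - 1) *: e_ n j.-1).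

Definition V_act2 (n : nat) (alpha : K * K) (j : nat) : 'rV[K]_n :=
  - (1 / 2%:R) *:
    ((if (j < n)%N then (2%:R * n%:R - j%:R) *: e_ n j.+1
      else (alpha.2 * n%:R) *: e_ n n)
     + (j%:R - 1) *: e_ n j.-1).

Definition V_act3 (n : nat) (alpha : K * K) (j : nat) : 'rV[K]_n :=
  (alpha.1 * ((-1) ^+ j / 2%:R) * (2%:R * n%:R - 2%:R * j%:R + 1)) *: e_ n j.

Definition W_act1 (n j : nat) : 'rV[K]_n :=
  ((-1) ^+ j.-1 / 2%:R) *:
    ((n%:R - j%:R) *: e_ n j.+1 - (j%:R - 1) *: e_ n j.-1).

Definition W_act2 (n j : nat) : 'rV[K]_n :=
  - (1 / 2%:R) *: ((n%:R - j%:R) *: e_ n j.+1 + (j%:R - 1) *: e_ n j.-1).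

Definition W_act3 (n j : nat) : 'rV[K]_n :=
  ((-1) ^+ j / 2%:R * (n%:R - 2%:R * j%:R + 1)) *: e_ n j.

(* The linear map sl2c -> End(K^n) for which the i-th basis vector of sl2c
   sends e_j to the j-th value of the i-th function. *)
Definition sl2c_map (n : nat) (act : 3.-tuple (nat -> 'rV[K]_n)) :
    'Hom(sl2c K, 'End('rV[K]_n)) :=
  linext (fun i : 'I_3 => linext (fun j : 'I_n => tnth act i j.+1)).

Lemma sl2c_mapE (n : nat) (act : 3.-tuple (nat -> 'rV[K]_n)) i j :
  (0 < j <= n)%N -> sl2c_map act (sl2c_a K i) (e_ n j) = tnth act i j.
Proof.
case: j => // j /= jn; rewrite /sl2c_map linext_delta.
rewrite (_ : e_ n j.+1 = delta_mx 0 (Ordinal jn)) ?linext_delta //.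
by apply/rowP => k; rewrite !mxE eqxx eqSS.
Qed.

Definition V_rep (n : nat) (alpha : K * K) : 'Hom(sl2c K, 'End('rV[K]_n)) :=
  sl2c_map [tuple V_act1 n alpha; V_act2 n alpha; V_act3 n alpha].

Definition W_rep (n : nat) : 'Hom(sl2c K, 'End('rV[K]_n)) :=
  sl2c_map [tuple W_act1 n; W_act2 n; W_act3 n].

End Models.

(* Main.v *)
(* Put X = a_1 + a_2, Y = a_1 - a_2 and C = a_3. The relations become
   C X = X (1 - C), C Y = Y (- 1 - C) and X^2 - Y^2 = 2 C, so X reflects the
   eigenvalues of C by l |-> 1 - l, and Y by l |-> - 1 - l. In a simple
   finite-dimensional representation some eigenvalue mu lacks one of its two
   reflections, since their composite is a translation by 2; twisting by
   a_1, a_3 |-> - a_1, - a_3 we may assume that it is 1 - mu, so that X kills the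
   mu-eigenspace. Write mu = (1 - N) / 2 and apply Y, X, Y, X, ... to an
   eigenvector x: going up and down again at the i-th step is multiplication by
   i (N - i), and the eigenvalues met are distinct as long as N is not an even
   natural number. In that case the chain must stop, which forces N = n odd and
   gives W^n. If N = 2m, the first m vectors have distinct eigenvalues and the
   next step preserves an eigenspace; as the chain of length 2m folds back onto
   itself, x can be chosen such that this step acts by the scalar +-m, and the
   representation is V_alpha^m. *)
Require Import Defs.
From mathcomp Require Import all_boot all_order all_algebra.
From mathcomp Require Import ring zify.
Set Implicit Arguments.
Unset Strict Implicit.
Unset Printing Implicit Defensive.
Import GRing.Theory.
Local Open Scope ring_scope.

(** * Eigenvectors with distinct eigenvalues, and eigenvalues over a closed field *)

Section Eigenvectors.
Context {K : fieldType} {V : vectType K}.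
Implicit Types (f : {linear V -> V}) (U : {vspace V}).
Implicit Types (mu : nat -> K) (v : nat -> V).

(** Induction on [m]: applying [f - mu m] to the sum kills the last component and multiplies the
    others by the nonzero scalars [mu i - mu m]. *)
Lemma eigenvector_components f U m mu v :
    (forall i j, (i < j < m)%N -> mu i != mu j) ->
    (forall i, (i < m)%N -> f (v i) = mu i *: v i) ->
    (forall x, x \in U -> f x \in U) ->
  \sum_(i < m) v i \in U -> forall i, (i < m)%N -> v i \in U.
Proof.
move=> + + fU; elim: m v => [|m IHm] v mu_inj fv; first by [].
rewrite big_ord_recr /= => sumU.
have vU i : (i < m)%N -> v i \in U.
  move=> im; have := rpredZeq U (mu i - mu m) (v i).
  rewrite subr_eq0 (negPf (mu_inj i m _)) ?im //= => <-.
  apply: (IHm (fun i => (mu i - mu m) *: v i)) im => [j k /andP[jk km]|j jm|].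
  - by rewrite mu_inj ?jk ?(leqW km).
  - by rewrite linearZ /= fv 1?ltnW // !scalerA mulrC.
  rewrite (_ : \sum_(_ < _) _ = f (\sum_(i < m) v i + v m)
                                - mu m *: (\sum_(i < m) v i + v m)).
    by rewrite memvB ?memvZ // fU.
  rewrite linearD /= fv // scalerDr opprD addrACA subrr addr0.
  rewrite linear_sum /= scaler_sumr -sumrB; apply: eq_bigr => j _.
  by rewrite fv ?scalerBl // ltnS ltnW.
move=> i; rewrite ltnS leq_eqVlt => /predU1P[->|/vU//].
rewrite -[v m](addKr (\sum_(i < m) v i)) memvD // memvN.
by apply: memv_suml => j _; apply: vU.
Qed.

(** This is the case [U = 0] of [eigenvector_components], applied to the terms of a linear
    relation. *)
Lemma eigenvectors_free f m mu v :
    (forall i j, (i < j < m)%N -> mu i != mu j) ->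
    (forall i, (i < m)%N -> f (v i) = mu i *: v i) ->
    (forall i, (i < m)%N -> v i != 0) ->
  free (mkseq v m).
Proof.
move=> mu_inj fv v0.
have sz : size (mkseq v m) == m by rewrite size_mkseq.
apply/(@freeP _ _ _ (Tuple sz)) => k /=.
under eq_bigr => i _ do rewrite nth_mkseq //.
move=> sum0 i.
(* The coefficients are extended by zero to a family indexed by [nat]. *)
pose k' j := if insub j is Some i then k i else 0.
have k'E (j : 'I_m) : k' j = k j by rewrite /k' valK.
have : k' i *: v i \in 0%VS.
  apply: (@eigenvector_components f 0 m mu (fun i => k' i *: v i)) => //.
  - by move=> j jm; rewrite linearZ /= fv // !scalerA mulrC.
  - by move=> x; rewrite !memv0 => /eqP->; rewrite linear0.
  by rewrite memv0; apply/eqP; rewrite -[RHS]sum0; apply: eq_bigr => j _; rewrite k'E.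
by rewrite memv0 k'E scaler_eq0 (negPf (v0 _ _)) // orbF => /eqP.
Qed.

Lemma eigenvectors_le_dim f m mu v :
    (forall i j, (i < j < m)%N -> mu i != mu j) ->
    (forall i, (i < m)%N -> f (v i) = mu i *: v i) ->
    (forall i, (i < m)%N -> v i != 0) ->
  (m <= \dim {:V})%N.
Proof.
move=> mu_inj fv v0; have := eigenvectors_free mu_inj fv v0.
by rewrite /free size_mkseq => /eqP {1}<-; rewrite dimvS ?subvf.
Qed.

Lemma mem_leigenspace (f : 'End(V)) a x : (x \in passmx.leigenspace f a) = (f x == a *: x).
Proof.
by rewrite memv_ker add_lfunE opp_lfunE scale_lfunE id_lfunE subr_eq0.
Qed.

Lemma leigenvalueP (f : 'End(V)) a :
  reflect (exists2 x, x != 0 & f x = a *: x) (passmx.leigenvalue f a).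
Proof.
apply: (iffP idP) => [f_a|[x x0 /eqP fx]].
  exists (vpick (passmx.leigenspace f a)); first by rewrite vpick0.
  by apply/eqP; rewrite -mem_leigenspace memv_pick.
apply: contraNneq x0 => f0; rewrite -memv0 -f0; by rewrite mem_leigenspace.
Qed.

End Eigenvectors.

(** The matrix of [f] in a basis has a characteristic polynomial of positive degree, hence with a
    root. *)
Lemma leigenvalue_closed (K : closedFieldType) (V : vectType K) (f : 'End(V)) :
  \dim {:V} != 0%N -> exists a, passmx.leigenvalue f a.
Proof.
move=> dimV; pose e := vbasis {:V}; have e_basis : basis_of {:V} e := vbasisP _.
have /closed_rootP[a]: size (char_poly (passmx.mxof e e f)) != 1%N.
  by rewrite size_char_poly eqSS.
rewrite -eigenvalue_root_char => f_a; exists a.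
by rewrite /passmx.leigenvalue (passmx.leigenspaceE e_basis) passmx.vsof_eq0.
Qed.

(* Otherwise [mu] and [mu - 2 = -1 - (1 - mu)] would always be eigenvalues
   together, giving infinitely many. *)
Lemma eigenvalue_missing_reflection (K : closedFieldType) (V : vectType K)
    (f : 'End(V)) :
    [pchar K] =i pred0 -> \dim {:V} != 0%N ->
  exists2 mu, passmx.leigenvalue f mu
    & ~~ passmx.leigenvalue f (1 - mu) \/ ~~ passmx.leigenvalue f (- 1 - mu).
Proof.
move=> /pcharf0P natK0 dimV; have [a f_a] := leigenvalue_closed f dimV.
pose goal := exists2 mu, passmx.leigenvalue f mu
  & ~~ passmx.leigenvalue f (1 - mu) \/ ~~ passmx.leigenvalue f (- 1 - mu).
have shift k : goal \/ forall j, (j <= k)%N -> passmx.leigenvalue f (a - j.*2%:R).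
  elim: k => [|k [?|IHk]]; first by right=> j; rewrite leqn0 => /eqP->; rewrite subr0.
    by left.
  have [f1|nf1] := boolP (passmx.leigenvalue f (1 - (a - k.*2%:R))); last first.
    by left; exists (a - k.*2%:R); [apply: IHk|left].
  have [f2|nf2] := boolP (passmx.leigenvalue f (- 1 - (1 - (a - k.*2%:R)))); last first.
    by left; exists (1 - (a - k.*2%:R)) => //; right.
  right=> j; rewrite leq_eqVlt => /predU1P[->|/IHk//].
  by congr (passmx.leigenvalue _ _): f2; rewrite doubleS -[(k.*2).+2]addn2 natrD; ring.
have [//|f_shift] := shift (\dim {:V}).
pose v j := vpick (passmx.leigenspace f (a - j.*2%:R)).
(* The eigenvalues [a - 2j] with [j <= \dim {:V}] are distinct, which is one too many. *)
suff : (\dim {:V} < \dim {:V})%N by rewrite ltnn.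
apply: (@eigenvectors_le_dim _ _ f _ (fun j => a - j.*2%:R) v) => [i j /andP[ij _]|i|i].
- rewrite (inj_eq (addrI a)) eqr_opp eq_sym -subr_eq0 -natrB ?leq_double 1?ltnW //.
  by rewrite natK0 subn_eq0 leq_double -ltnNge.
- by move=> _; apply/eqP; rewrite -mem_leigenspace memv_pick.
- by rewrite vpick0; apply: f_shift.
Qed.

(* The parameters of [W_rep] (on the left) and of [V_rep] (on the right, with
   [t = alpha2 * n]). *)
Definition ladder_end (K : fieldType) (n : nat) (N t : K) : Prop :=
  (N = n%:R /\ odd n /\ t = 0) \/ (N = n.*2%:R /\ (t = n%:R \/ t = - n%:R)).

(** * The alternating chain generated from an eigenvector of [C] *)

Section Chain.
Context {K : fieldType} {V : vectType K} (X Y C : {linear V -> V}).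
Hypothesis charK0 : [pchar K] =i pred0.
Hypothesis CX : forall x, C (X x) = X x - X (C x).
Hypothesis CY : forall x, C (Y x) = - Y x - Y (C x).
Hypothesis XXYY : forall x, X (X x) - Y (Y x) = 2%:R *: C x.

Let natK0 n : (n%:R == 0 :> K) = (n == 0)%N.
Proof. by move: n; apply/pcharf0P. Qed.

Let two0 : 2%:R != 0 :> K.
Proof. by rewrite natK0. Qed.

(* With [X = a_1 + a_2], [Y = a_1 - a_2] and [C = a_3], [X] maps the eigenspace
   of [l] to that of [1 - l], and [Y] to that of [- 1 - l]. *)
Definition chain_step i : {linear V -> V} := if odd i then X else Y.

Fixpoint chain i x : V := if i is j.+1 then chain_step j (chain j x) else x.

(** Closed form of the sequence that starts at [(1 - N) / 2] and is reflected alternately by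
    [l |-> - 1 - l] and [l |-> 1 - l]. *)
Definition chain_eigenvalue (N : K) i : K :=
  (-1) ^+ i * (i.*2.+1%:R - N) / 2%:R.

Lemma chain_eigenvalueS N i :
  chain_eigenvalue N i.+1 = - (-1) ^+ i - chain_eigenvalue N i.
Proof.
by rewrite /chain_eigenvalue doubleS -[i.*2.+3]addn2 natrD exprS; field.
Qed.

(** For indices of equal parity the two values differ by [+-(j - i)]; for opposite parity they agree
    exactly when [N = i + j + 1]. *)
Lemma chain_eigenvalue_neq N i j : (i < j)%N ->
  (odd (i + j) -> N != (i + j).+1%:R) ->
  chain_eigenvalue N i != chain_eigenvalue N j.
Proof.
move=> ij Nij; rewrite /chain_eigenvalue -(signr_odd _ i) -(signr_odd _ j).
have i_j: i.*2.+1%:R != j.*2.+1%:R :> K.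
  rewrite eq_sym -subr_eq0 -natrB ?ltnS ?leq_double 1?ltnW // natK0.
  by rewrite subn_eq0 ltnS leq_double -ltnNge.
have ijN : odd (i + j) -> i.*2.+1%:R - N != N - j.*2.+1%:R.
  move=> /Nij; apply: contraNneq => /eqP.
  rewrite subr_eq addrAC -subr_eq opprK -natrD => /eqP e.
  apply/eqP/(mulfI two0); rewrite -natrM mulr_natl mulr2n -e.
  by congr (_%:R); lia.
rewrite (inj_eq (mulIf (invr_neq0 two0))); move: ijN; rewrite oddD.
case: (odd i) (odd j) => [] [] //= ijN; rewrite ?expr0 ?expr1 ?mulN1r ?mul1r.
- by rewrite eqr_opp (inj_eq (addIr _)).
- by rewrite -eqr_opp opprK opprB ijN.
- by rewrite opprB ijN.
- by rewrite (inj_eq (addIr _)).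
Qed.

Lemma chain_linear i a x y : chain i (a *: x + y) = a *: chain i x + chain i y.
Proof. by elim: i => //= i ->; rewrite linearP. Qed.

Section Vector.
Variables (N : K) (x : V).
Hypothesis Cx : C x = ((1 - N) / 2%:R) *: x.

Lemma chain_eigenvector i : C (chain i x) = chain_eigenvalue N i *: chain i x.
Proof.
elim: i => [|i IHi] /=.
  by rewrite Cx /chain_eigenvalue expr0 mul1r.
rewrite chain_eigenvalueS scalerBl scaleNr.
have -> : C (chain_step i (chain i x)) =
    - ((-1) ^+ i *: chain_step i (chain i x)) - chain_step i (C (chain i x)).
  rewrite -signr_odd /chain_step; case: (odd i).
    by rewrite expr1 scaleN1r opprK CX.
  by rewrite expr0 scale1r CY.
by rewrite IHi [chain_step i (_ *: _)]linearZ.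
Qed.

Hypothesis Xx : X x = 0.

(** Induction on [i]: by [XXYY] the squares of consecutive steps differ by [+-2 C], and [C] acts on
    each chain vector by a known scalar. The base case uses [X x = 0]. *)
Lemma chain_down i :
  chain_step i (chain i.+1 x) = (i.+1%:R * (N - i.+1%:R)) *: chain i x.
Proof.
elim: i => [|i IHi].
  have /= := XXYY x; rewrite Xx linear0 sub0r Cx /chain_step /= => e.
  by rewrite -[LHS]opprK e scalerA -scaleNr; congr (_ *: _); field.
have step2 y : chain_step i.+1 (chain_step i.+1 y) =
    chain_step i (chain_step i y) + (2%:R * (-1) ^+ i) *: C y.
  rewrite [2%:R * _]mulrC -scalerA -XXYY -signr_odd /chain_step /=.
  case: (odd i) => /=.
    by rewrite expr1 scaleN1r opprB addrC subrK.
  by rewrite expr0 scale1r addrC subrK.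
rewrite -[chain i.+2 x]/(chain_step i.+1 (chain i.+1 x)) step2 IHi linearZ /=.
rewrite -/(chain i.+1 x).
rewrite chain_eigenvector scalerA -scalerDl; congr (_ *: _).
rewrite /chain_eigenvalue exprS doubleS.
rewrite -[i.*2.+3]addn3 -[i.+2]addn2 -[i.+1]addn1 -mul2n !(natrD, natrM).
have s2 : (-1) ^+ i * (-1) ^+ i = 1 :> K by rewrite -expr2 sqrr_sign.
transitivity ((i%:R + 1) * (N - (i%:R + 1))
   - ((-1) ^+ i * (-1) ^+ i) * (2%:R * i%:R + 3%:R - N)).
  by field.
by rewrite s2; ring.
Qed.

Lemma chain_neq0 m : x != 0 ->
  (forall i, (0 < i <= m)%N -> N != i%:R) -> chain m x != 0.
Proof.
move=> x0; elim: m => [//|m IHm] Nm.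
apply: contraNneq (IHm _) => [|i /andP[i0 im]]; last by rewrite Nm ?i0 ?(leqW im).
move=> xm; have := chain_down m; rewrite xm linear0 => /esym/eqP.
rewrite scaler_eq0 mulf_eq0 natK0 /= subr_eq0.
by rewrite (negPf (Nm _ _)) //= leqnn.
Qed.

(* For [N = 2m] the chain folds back: it is invariant under [i -> 2m - 1 - i],
   both the parity of the step and the weight [i (2m - i)] being symmetric. *)
Lemma chain_fold m i : N = m.*2%:R -> (i < m.*2)%N ->
  exists2 c, c != 0 & chain i (chain m.*2.-1 x) = c *: chain (m.*2.-1 - i) x.
Proof.
move=> Nm; elim: i => [|i IHi] im.
  by exists 1; rewrite ?oner_eq0 //= scale1r subn0.
have [c c0 IH] := IHi (ltnW im); pose j := (m.*2.-1 - i.+1)%N.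
have jE : (m.*2.-1 - i)%N = j.+1 by rewrite /j; lia.
exists (c * (j.+1%:R * (N - j.+1%:R))).
  rewrite mulf_neq0 // mulf_neq0 ?natK0 // Nm -natrB ?natK0; lia.
(* Since [j = 2m - 2 - i] has the parity of [i], the next step up from the far end is the step down
   from index [j + 1] to [j]. *)
have -> : chain i.+1 (chain m.*2.-1 x) = chain_step j (chain i (chain m.*2.-1 x)).
  by rewrite /= /chain_step (_ : odd j = odd i) // /j; lia.
by rewrite IH jE linearZ /= [chain_step j _]chain_down scalerA.
Qed.

End Vector.

(** If [N = 2m], the chain folds onto itself and [y] is chosen to diagonalize the fold. Otherwise
    the eigenvalues along the chain are distinct, so it vanishes at some first index [m], and
    [chain_down] forces [N = m]. *)
Lemma chain_length N x : (x != 0) -> C x = ((1 - N) / 2%:R) *: x ->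
    (forall y, C y = ((1 - N) / 2%:R) *: y -> X y = 0) ->
  exists m y s, [/\ (0 < m)%N, y != 0, C y = ((1 - N) / 2%:R) *: y,
    chain m y = s *: chain m.-1 y
    & ladder_end m N s].
Proof.
move=> x0 Cx X0; have Xx := X0 _ Cx.
(* Bounding [m] by the dimension makes the alternative decidable; a larger even [N] causes no
   coincidence among the first [\dim {:V} + 1] eigenvalues. *)
have [/existsP[[m /= _] /andP[m0 /eqP Nm]]|/existsPn Nodd] :=
    boolP [exists m : 'I_(\dim {:V}).+1, (0 < m)%N && (N == (m : nat).*2%:R)].
  pose u := chain m.*2.-1 x.
  have [|c c0 uc] := @chain_fold N x Cx Xx m m.-1 Nm; first by lia.
  rewrite -/u (_ : (_ - _)%N = m) in uc; last by lia.
  have um : chain m u = (c * m%:R ^+ 2) *: chain m.-1 x.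
    rewrite -{1}(prednK m0) /= uc linearZ /= -[chain m x](congr1 (chain^~ x) (prednK m0)).
    rewrite [chain_step _ _](chain_down Cx Xx) prednK // scalerA; congr (_ *: _).
    by rewrite Nm -addnn natrD; ring.
  have Cu : C u = ((1 - N) / 2%:R) *: u.
    rewrite (chain_eigenvector Cx); congr (_ *: _); rewrite /chain_eigenvalue Nm.
    have -> : m.*2.-1 = (m.-1).*2.+1 by lia.
    rewrite -signr_odd /= odd_double /= expr1.
    have -> : (m.-1.*2.+1).*2.+1 = (m.*2 + m.*2 - 1)%N by lia.
    by rewrite natrB ?natrD; [field|lia].
  (* By [um] and [uc], the vector [y = u + c m x] satisfies [chain m y = m chain m.-1 y]. If it is
     zero, then [u = - c m x], and [uc] shows that [x] itself has the scalar [- m]. *)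
  have [e|ne] := eqVneq (u + (c * m%:R) *: x) 0; last first.
    exists m, (u + (c * m%:R) *: x), m%:R; split=> //; last by right; split=> //; left.
    - by rewrite linearD linearZ /= Cu Cx scalerDr !scalerA [_ * (c * _)]mulrC.
    rewrite ![u + _]addrC !chain_linear um uc scalerDr addrC !scalerA.
    by congr (_ *: _ + _ *: _); ring.
  exists m, x, (- m%:R); split=> //; last by right; split=> //; right.
  apply: (scalerI c0); rewrite -uc.
  have -> : u = - (c * m%:R) *: x + 0.
    by rewrite addr0 scaleNr; apply/eqP; rewrite -addr_eq0 e.
  rewrite chain_linear (_ : chain m.-1 0 = 0) ?addr0 ?scalerA ?mulrN //.
  by elim: (m.-1) => //= i ->; rewrite linear0.
(* A coincidence would make [N = i + j + 1] even with half at most the dimension, which is the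
   excluded case. *)
have ev_neq i j : (i < j < (\dim {:V}).+1)%N ->
    chain_eigenvalue N i != chain_eigenvalue N j.
  move=> /andP[ij jm]; apply: chain_eigenvalue_neq => // oij.
  have ijm : ((i + j).+1./2 < (\dim {:V}).+1)%N by lia.
  have := Nodd (Ordinal ijm); rewrite /= negb_and (_ : (_.*2)%N = (i + j).+1).
    by case/orP=> //; lia.
  by lia.
have [/forallP chain0|/forallPn[[i /= im]]] :=
    boolP [forall i : 'I_(\dim {:V}).+1, chain i x != 0].
  suff : (\dim {:V} < \dim {:V})%N by rewrite ltnn.
  apply: (@eigenvectors_le_dim _ _ C _ _ (chain^~ x) ev_neq) => i im.
    exact: chain_eigenvector.
  exact: (chain0 (Ordinal im)).
rewrite negbK => xi0.
have ex0 : exists i, chain i x == 0 by exists i.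
case: (ex_minnP ex0) => m xm0 m_min.
have m0 : (0 < m)%N by case: m xm0 {m_min} => //=; rewrite (negPf x0).
(* Stepping down from the zero vector at [m] gives [m (N - m) = 0], because the chain is nonzero at
   [m - 1]. *)
have Nm : N = m%:R.
  have := chain_down Cx Xx m.-1; rewrite prednK // (eqP xm0) linear0 => /esym/eqP.
  rewrite scaler_eq0 mulf_eq0 natK0 eqn0Ngt m0 /= subr_eq0 => /orP[/eqP//|/m_min].
  by lia.
exists m, x, 0; split=> //; first by rewrite scale0r; apply/eqP.
left; split=> //; split=> //; apply: contraT => m_even.
have mi := leq_trans (m_min _ xi0) im.
have mh : (m./2 < (\dim {:V}).+1)%N by have := m_min _ xi0; lia.
have := Nodd (Ordinal mh); rewrite /= Nm (_ : (m./2).*2 = m); last by lia.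
by rewrite eqxx andbT; lia.
Qed.

End Chain.

(** * Ladders, and their construction in a simple representation *)

Lemma span_stable (K : fieldType) (V W : vectType K) (f : {linear V -> W})
    (s : seq V) (U : {vspace W}) :
  {in s, forall x, f x \in U} -> {in <<s>>%VS, forall x, f x \in U}.
Proof.
move=> fs x; rewrite -{1}[s]/(tval (in_tuple s)) => /coord_span ->.
rewrite linear_sum memv_suml // => i _; rewrite linearZ memvZ // fs //.
by rewrite mem_nth.
Qed.

(* The action on the basis of [V_rep] and [W_rep], indexed from [0]; [eps] is
   [alpha1], and [1] for [W_rep]. *)
Definition ladder (K : fieldType) (V : lmodType K) (n : nat) (eps N t : K)
    (A B C : V -> V) (e : nat -> V) : Prop :=
  forall i, (i < n)%N ->
    let up := if (i.+1 < n)%N then (N - i.+1%:R) *: e i.+1 else t *: e i in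
    [/\ A (e i) = (eps * ((-1) ^+ i / 2%:R)) *: (up - i%:R *: e i.-1),
        B (e i) = - (1 / 2%:R) *: (up + i%:R *: e i.-1)
      & C (e i) = (eps * chain_eigenvalue N i) *: e i].

Lemma eqr_nat_char0 (R : idomainType) : [pchar R] =i pred0 ->
  forall m n, (m%:R == n%:R :> R) = (m == n).
Proof.
move=> charR0 m n; have natR0 := (pcharf0P R).1 charR0.
wlog mn : m n / (m <= n)%N => [hw|].
  by have [/hw//|/ltnW nm] := leqP m n; rewrite eq_sym hw // eq_sym.
by rewrite eq_sym -subr_eq0 -natrB // natR0 subn_eq0 eqn_leq mn.
Qed.

Lemma ladder_coef_neq0 (K : fieldType) (n : nat) (N t : K) :
    [pchar K] =i pred0 -> ladder_end n N t ->
  forall i, (i.+1 < n)%N -> N - i.+1%:R != 0.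
Proof.
move=> charK0 Nn i i1n; rewrite subr_eq0.
by case: Nn => [[-> _]|[-> _]]; rewrite eqr_nat_char0 //; lia.
Qed.

(** A coincidence needs [N = i + j + 1] with [i + j] odd; but [N] is either odd or equal to [2n],
    which exceeds [i + j + 1]. *)
Lemma ladder_eigenvalue_neq (K : fieldType) (n : nat) (N t : K) :
    [pchar K] =i pred0 -> ladder_end n N t ->
  forall i j, (i < j < n)%N -> chain_eigenvalue N i != chain_eigenvalue N j.
Proof.
move=> charK0 Nn i j /andP[ij jn].
apply: chain_eigenvalue_neq => // ij_odd.
by case: Nn => [[-> [n_odd _]]|[-> _]]; rewrite eqr_nat_char0 //; lia.
Qed.

Section LowestWeight.
Context {K : fieldType} {V : vectType K} (A B C : {linear V -> V}).
Hypothesis charK0 : [pchar K] =i pred0.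
Hypothesis relAB : forall x, (A (B x) : V) + B (A x) = C x :> V.
Hypothesis relBC : forall x, (B (C x) : V) + C (B x) = A x :> V.
Hypothesis relCA : forall x, (C (A x) : V) + A (C x) = B x :> V.
Hypothesis simpleABC : forall U : {vspace V},
  {in U, forall x, A x \in U} -> {in U, forall x, B x \in U} ->
  {in U, forall x, C x \in U} -> U = 0%VS \/ U = fullv.

Let natK0 n : (n%:R == 0 :> K) = (n == 0)%N.
Proof. by move: n; apply/pcharf0P. Qed.

Let two0 : 2%:R != 0 :> K.
Proof. by rewrite natK0. Qed.

(** The chain of [chain_length] is rescaled to a ladder. Its members have distinct eigenvalues, so
    they are independent; their span is stable, so simplicity makes it the whole space. *)
Lemma lowest_weight_basis mu x : x != 0 -> C x = mu *: x ->
    (forall y, C y = (1 - mu) *: y -> y = 0) ->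
  let n := \dim {:V} in
  exists (e : nat -> V) (N t : K),
    [/\ basis_of {:V} (mkseq e n), ladder_end n N t & ladder n 1 N t A B C e].
Proof.
move=> x0 Cx no_refl n.
have [X XE] : exists X : {linear V -> V}, forall y, X y = A y + B y.
  by exists (A \+ B)%R.
have [Y YE] : exists Y : {linear V -> V}, forall y, Y y = A y - B y.
  by exists (A \- B)%R.
have CA y : C (A y) = (B y : V) - A (C y) by rewrite -relCA addrK.
have CB y : C (B y) = (A y : V) - B (C y) by rewrite -relBC addrAC subrr add0r.
have CX y : C (X y) = X y - X (C y).
  by rewrite !XE linearD /= CA CB addrACA -opprD [B y + _]addrC.
have CY y : C (Y y) = - Y y - Y (C y).
  rewrite !YE linearB /= CA CB !opprB.
  move: (A y) (B y) (A (C y)) (B (C y)) => a b a' b'.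
  by rewrite addrACA [RHS]addrACA [- a' - a]addrC.
have XXYY y : X (X y) - Y (Y y) = 2%:R *: C y.
  rewrite !(XE, YE) !linearB !linearD /= -relAB scaler_nat mulr2n.
  move: (A (A y)) (A (B y)) (B (A y)) (B (B y)) => a b c d.
  rewrite !opprK addrACA [a + b + _]addrACA [c + d + _]addrACA !subrr.
  by rewrite add0r addr0 addrACA.
have [N muN] : exists N, mu = (1 - N) / 2%:R.
  by exists (1 - 2%:R * mu); field.
rewrite {}muN in Cx no_refl.
have X0 y : C y = ((1 - N) / 2%:R) *: y -> X y = 0.
  by move=> Cy; apply: no_refl; rewrite CX Cy linearZ scalerBl scale1r.
have [m [y [s [m0 y0 Cy ym Nm]]]] := chain_length charK0 CX CY XXYY x0 Cx X0.
have Xy := X0 _ Cy.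
(* This scaling gives the step up from [e i] the coefficient [(-1)^i (N - i - 1)], and the step down
   the coefficient [- (-1)^i i]. *)
pose c i : K := \prod_(j < i) ((-1) ^+ j / (N - j.+1%:R)).
have N_neq := ladder_coef_neq0 charK0 Nm.
have c0 i : (i < m)%N -> c i != 0.
  move=> im; apply/prodf_neq0 => j _.
  by rewrite mulf_neq0 ?signr_eq0 ?invr_neq0 ?N_neq // (leq_ltn_trans _ im).
have s2 i : (-1) ^+ i * (-1) ^+ i = 1 :> K by rewrite -expr2 sqrr_sign.
pose e i := c i *: chain X Y i y.
(* The sign of the last step is absorbed in [t]; the values permitted by [ladder_end] are stable
   under it. *)
pose t := (-1) ^+ m.-1 * s.
pose up i := if (i.+1 < m)%N then (N - i.+1%:R) *: e i.+1 else t *: e i.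
have e_up i : (i < m)%N -> chain_step X Y i (e i) = (-1) ^+ i *: up i.
  move=> im; rewrite /up /e linearZ /= -/(chain X Y i.+1 y).
  case: ltnP => [im1|mi].
    rewrite !scalerA; congr (_ *: _).
    rewrite /c big_ord_recr /= -/(c i).
    transitivity (c i * ((-1) ^+ i * (-1) ^+ i)); first by rewrite s2 mulr1.
    by move: (N_neq _ im1); move: (N - _) => d d0; field.
  have -> : i = m.-1 by lia.
  rewrite (prednK m0) ym !scalerA; congr (_ *: _).
  by rewrite /t !mulrA s2 mul1r mulrC.
(* The operator here is the one other than [chain_step X Y i], that is, the one that produced [e i]
   from [e i.-1]. *)
have e_down i : (i < m)%N ->
    (if odd i then Y else X) (e i) = - ((-1) ^+ i * i%:R) *: e i.-1.
  case: i => [|i] im; first by rewrite /e linearZ /= Xy scaler0 mulr0 oppr0 scale0r.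
  have -> : (if odd i.+1 then Y else X) = chain_step X Y i.
    by rewrite /chain_step /=; case: (odd i).
  rewrite /e [LHS]linearZ /= -/(chain X Y i.+1 y) (chain_down charK0 CX CY XXYY Cy Xy).
  rewrite !scalerA; congr (_ *: _); rewrite /c big_ord_recr /= -/(c i) exprS.
  by move: (N_neq _ im); move: (N - _) => d d0; field.
have half z : A z = (1 / 2%:R) *: (X z + Y z).
  rewrite XE YE addrACA subrr addr0 -mulr2n -scaler_nat scalerA.
  by rewrite mulfVK ?scale1r.
have halfB z : B z = (1 / 2%:R) *: (X z - Y z).
  rewrite XE YE opprB [A z + B z]addrC addrACA subrr addr0 -mulr2n -scaler_nat.
  by rewrite scalerA mulfVK ?scale1r.
have eA i : (i < m)%N ->
    A (e i) = ((-1) ^+ i / 2%:R) *: (up i - i%:R *: e i.-1).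
  move=> im; have -> : A (e i) = (1 / 2%:R) *: (chain_step X Y i (e i) +
      (if odd i then Y else X) (e i)).
    by rewrite half /chain_step; case: (odd i); rewrite // addrC.
  rewrite e_up // e_down // scaleNr -[(_ * i%:R) *: _]scalerA -scalerBr scalerA; congr (_ *: _).
  by rewrite mul1r mulrC.
have eB i : (i < m)%N -> B (e i) = - (1 / 2%:R) *: (up i + i%:R *: e i.-1).
  move=> im; have -> : B (e i) = ((-1) ^+ i / 2%:R) *:
      ((if odd i then Y else X) (e i) - chain_step X Y i (e i)).
    rewrite halfB /chain_step -signr_odd; case: (odd i).
      by rewrite expr1 -[RHS]opprK -scalerN opprB mulN1r scaleNr opprK mul1r.
    by rewrite expr0.
  rewrite e_up // e_down // scaleNr -[(_ * i%:R) *: _]scalerA -opprD -scalerDr -scaleNr scalerA.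
  rewrite [up i + _]addrC; congr (_ *: _).
  transitivity (- ((-1) ^+ i * (-1) ^+ i / 2%:R) : K); first by field.
  by rewrite s2.
have eC i : (i < m)%N -> C (e i) = chain_eigenvalue N i *: e i.
  move=> _.
  by rewrite linearZ /= (chain_eigenvector charK0 CX CY Cy) !scalerA mulrC.
have e0 i : (i < m)%N -> e i != 0.
  move=> im; rewrite scaler_eq0 negb_or c0 //.
  apply: (chain_neq0 charK0 CX CY XXYY Cy Xy y0) => -[//|j] /= ji.
  by rewrite -subr_eq0 N_neq // (leq_ltn_trans ji).
have e_free : free (mkseq e m).
  exact: (@eigenvectors_free _ _ C m (chain_eigenvalue N))
           (ladder_eigenvalue_neq charK0 Nm) eC e0.
pose U := <<mkseq e m>>%VS.
have eU i : (i < m)%N -> e i \in U.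
  by move=> im; apply/memv_span/mapP; exists i; rewrite ?mem_iota.
have upU i : (i < m)%N -> up i \in U.
  by move=> im; rewrite /up; case: ltnP => [im1|_]; rewrite memvZ ?eU.
have downU i : (i < m)%N -> e i.-1 \in U.
  by move=> im; rewrite eU // (leq_ltn_trans (leq_pred i)).
have [||||U1] := @simpleABC U.
- apply: span_stable => _ /mapP[i + ->]; rewrite mem_iota /= => im.
  by rewrite eA // memvZ // memvB ?upU // memvZ ?downU.
- apply: span_stable => _ /mapP[i + ->]; rewrite mem_iota /= => im.
  by rewrite eB // memvZ // memvD ?upU // memvZ ?downU.
- apply: span_stable => _ /mapP[i + ->]; rewrite mem_iota /= => im.
  by rewrite eC // memvZ // eU.
- move=> U1; have := eU _ m0; rewrite U1 memv0 => e00.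
  by have := e0 _ m0; rewrite e00.
have e_basis : basis_of {:V} (mkseq e m) by rewrite /basis_of -/U U1 eqxx e_free.
have mn : m = n by rewrite /n (size_basis e_basis).
rewrite -mn; exists e, N, t; split=> // [|i im]; last first.
  by split; [rewrite mul1r; apply: eA|apply: eB|rewrite mul1r; apply: eC].
case: Nm => [[-> [m_odd s0]]|[-> st]]; [left|right]; split=> //.
  by rewrite /t s0 mulr0.
rewrite /t -signr_odd; case: odd; rewrite ?expr0 ?mul1r ?expr1 ?mulN1r //.
by case: st => ->; rewrite ?opprK; [right|left].
Qed.

End LowestWeight.

(** * Representations in terms of the three generators *)

Lemma ord3P (i : 'I_3) : [\/ i = 0, i = 1 | i = 2%:R].
Proof.
by case: i => [[|[|[|//]]] p]; [constructor 1|constructor 2|constructor 3];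
  apply: val_inj.
Qed.

Section Representations.
Context {K : fieldType}.

(** These are the defining relations of the universal enveloping algebra. *)
Definition sl2c_relations (V : vectType K) (rho : 'Hom(sl2c K, 'End(V))) : Prop :=
  let A := rho (sl2c_a K 0) in
  let B := rho (sl2c_a K 1) in
  let C := rho (sl2c_a K 2%:R) in
  [/\ forall x, (A (B x) : V) + B (A x) = C x,
      forall x, (B (C x) : V) + C (B x) = A x
    & forall x, (C (A x) : V) + A (C x) = B x].

Lemma sl2c_a_hom i : sl2c_a K i \in sl2c_hom K (sl2c_deg i).
Proof.
rewrite mem_sl2c_hom; apply/forallP => j; apply/implyP.
by rewrite mxE eqxx /=; case: (eqVneq j i) => [->|_ _]; rewrite ?eqxx.
Qed.

(** Homogeneous vectors are multiples of the [sl2c_a K i], so by bilinearity only pairs of these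
    matter. The commutation factor is [-1] for distinct ones; for equal ones both sides vanish. *)
Lemma is_repP (V : vectType K) (rho : 'Hom(sl2c K, 'End(V))) :
  is_rep rho <-> sl2c_relations rho.
Proof.
have epsN i j : i != j -> sl2c_eps K (sl2c_deg i) (sl2c_deg j) = -1.
  by move: i j => [[|[|[|//]]] ?] [[|[|[|//]]] ?].
have eps1 i : sl2c_eps K (sl2c_deg i) (sl2c_deg i) = 1.
  by move: i => [[|[|[|//]]] ?].
split=> [repP|[relAB relBC relCA]].
  have rel i j x : i != j -> rho (sl2c_br (sl2c_a K i) (sl2c_a K j)) x =
      (rho (sl2c_a K i) (rho (sl2c_a K j) x) : V)
      + rho (sl2c_a K j) (rho (sl2c_a K i) x).
    move=> ij.
    rewrite (repP _ _ _ _ (sl2c_a_hom i) (sl2c_a_hom j)) /= epsN //.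
    by rewrite scaleN1r opprK add_lfunE !comp_lfunE.
  split=> x.
  - by rewrite -(rel 0 1) // sl2c_br12.
  - by rewrite -(rel 1 2%:R) // sl2c_br23.
  - by rewrite -(rel 2%:R 0) // sl2c_br31.
have base i j : rho (sl2c_br (sl2c_a K i) (sl2c_a K j)) =
    (rho (sl2c_a K i) \o rho (sl2c_a K j))%VF
    - sl2c_eps K (sl2c_deg i) (sl2c_deg j)
      *: (rho (sl2c_a K j) \o rho (sl2c_a K i))%VF.
  have [<-|ij] := eqVneq i j.
    by rewrite sl2c_br_diag linear0 eps1 scale1r subrr.
  rewrite epsN // scaleN1r opprK; apply/lfunP => x.
  rewrite add_lfunE !comp_lfunE.
  by move: ij; case: (ord3P i) => ->; case: (ord3P j) => -> // _;
    (rewrite ?sl2c_br12 ?sl2c_br23 ?sl2c_br31 ?relAB ?relBC ?relCA //);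
    rewrite sl2c_brC addrC ?sl2c_br12 ?sl2c_br23 ?sl2c_br31
      ?relAB ?relBC ?relCA.
have homE g x : x \in sl2c_hom K g ->
    x = 0 \/ exists i c, g = sl2c_deg i /\ x = c *: sl2c_a K i.
  by case/sl2c_homP => [->|[-> [c ->]]|[-> [c ->]]|[-> [c ->]]];
    [left|right; exists 0, c|right; exists 1, c|right; exists 2%:R, c].
move=> g h x y /homE[->|[i [c [-> ->]]]] /homE[->|[j [d [-> ->]]]] /=;
  rewrite ?(sl2c_br0, linear0, comp_lfun0l, comp_lfun0r, scaler0, subr0) //.
rewrite sl2c_br_scale !linearZ /= base scalerBr.
rewrite -!(comp_lfunZl, comp_lfunZr) scalerN !scalerA; congr (_ - _ *: _).
by rewrite mulrC [d * c]mulrC.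
Qed.

Lemma sl2c_stable (V : vectType K) (rho : 'Hom(sl2c K, 'End(V))) (U : {vspace V}) :
    (forall i x, x \in U -> rho (sl2c_a K i) x \in U) ->
  forall x, (rho x @: U <= U)%VS.
Proof.
move=> aU x; apply/subvP => _ /memv_imgP[u uU ->].
rewrite [x](row_sum_delta) linear_sum sum_lfunE memv_suml // => i _.
by rewrite linearZ scale_lfunE memvZ // aU.
Qed.

Lemma rep_iso_sym (V W : vectType K) (rho : 'Hom(sl2c K, 'End(V)))
    (sigma : 'Hom(sl2c K, 'End(W))) : rep_iso rho sigma -> rep_iso sigma rho.
Proof.
case=> f f_bij f_rho.
have kerf : lker f == 0%VS by apply/lker0P/bij_inj.
have fK : cancel (f^-1)%VF f.
  move=> y; have [g _ gK] := f_bij.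
  by rewrite -{1}[y]gK lker0_lfunK.
exists (f^-1)%VF; first by exists f => //; apply: lker0_lfunK.
by move=> x v; apply: (bij_inj f_bij); rewrite f_rho !fK.
Qed.

Lemma rep_iso_basis n (V : vectType K) (rho : 'Hom(sl2c K, 'End(V)))
    (sigma : 'Hom(sl2c K, 'End('rV[K]_n))) (e : nat -> V) :
    basis_of {:V} (mkseq e n) ->
    (forall i (j : 'I_n), linext (fun k : 'I_n => e k) (sigma (sl2c_a K i) (delta_mx 0 j))
        = rho (sl2c_a K i) (e j)) ->
  rep_iso rho sigma.
Proof.
set g := linext _ => e_basis gE; apply: rep_iso_sym; exists g; last first.
  have ga i v : g (sigma (sl2c_a K i) v) = rho (sl2c_a K i) (g v).
    rewrite [v]row_sum_delta !linear_sum /=; apply: eq_bigr => j _.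
    by rewrite !linearZ /= gE /g linext_delta.
  move=> x v; rewrite [x]row_sum_delta !linear_sum !sum_lfunE linear_sum /=.
  apply: eq_bigr => i _; rewrite !linearZ !scale_lfunE /= linearZ; congr (_ *: _).
  exact: ga.
have sz : size (mkseq e n) == n by rewrite size_mkseq.
pose X := Tuple sz; have X_basis : basis_of {:V} X by [].
have XE (i : 'I_n) : e i = X`_i by rewrite nth_mkseq.
exists (fun y => \row_i coord X i y) => [v|y]; rewrite /g linextE.
  apply/rowP=> i; rewrite mxE; under eq_bigr do rewrite XE.
  by rewrite coord_sum_free // (basis_free X_basis).
rewrite [RHS](coord_basis X_basis (memvf y)); apply: eq_bigr => i _.
by rewrite mxE XE.
Qed.

End Representations.

(* [e_], indexed from 0. *)
Definition e0_ {K : fieldType} n i : 'rV[K]_n := e_ n i.+1.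

(** * The models [V_rep] and [W_rep] as ladders *)

Section Ladders.
Context {K : fieldType}.

Definition rep_ladder (V : vectType K) (rho : 'Hom(sl2c K, 'End(V)))
    (n : nat) (eps N t : K) (e : nat -> V) : Prop :=
  ladder n eps N t (rho (sl2c_a K 0)) (rho (sl2c_a K 1)) (rho (sl2c_a K 2%:R)) e.

Lemma e0_delta n (i : 'I_n) : delta_mx 0 i = e0_ n i :> 'rV[K]_n.
Proof. by apply/rowP => k; rewrite !mxE eqxx eqSS. Qed.

(** At [i = 0] the vectors differ, since [e_ n 0] is zero while [0.-1] is [0]; the coefficient [i]
    hides this. *)
Let e_pred n i : i%:R *: e_ n i = i%:R *: e0_ n i.-1 :> 'rV[K]_n.
Proof. by case: i => [|//]; rewrite !scale0r. Qed.

Let natr_pred i : i.+1%:R - 1 = i%:R :> K.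
Proof. by rewrite -addn1 natrD addrK. Qed.

Lemma V_rep_ladder n (alpha : K * K) :
  rep_ladder (V_rep n alpha) n alpha.1 n.*2%:R (alpha.2 * n%:R) (e0_ n).
Proof.
move=> i im /=; rewrite {1 5 9}/e0_ /V_rep !sl2c_mapE //.
rewrite /tnth /= /V_act1 /V_act2 /V_act3 /= natr_pred e_pred.
rewrite -natrM mul2n; split.
- congr (_ *: (_ - _)); case: ltnP => // ni.
  by rewrite /e0_ (_ : i.+1 = n) //; lia.
- congr (_ *: (_ + _)); case: ltnP => // ni.
  by rewrite /e0_ (_ : i.+1 = n) //; lia.
congr (_ *: _); rewrite /chain_eigenvalue exprS -[i.*2.+1]addn1 -[i.+1]addn1.
by rewrite -!mul2n !(natrD, natrM); ring.
Qed.

Lemma W_rep_ladder n : rep_ladder (W_rep n) n 1 n%:R 0 (e0_ n).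
Proof.
(* At the last index the coefficient [n - (i + 1)] vanishes, which matches the branch with
   [t = 0]. *)
have up0 i : (i < n)%N -> (n%:R - i.+1%:R) *: e_ n i.+2 =
    if (i.+1 < n)%N then (n%:R - i.+1%:R) *: e0_ n i.+1 else 0 *: e0_ n i :> 'rV[K]_n.
  move=> im; case: ltnP => // ni; rewrite (_ : i.+1 = n); last by lia.
  by rewrite subrr !scale0r.
move=> i im /=; rewrite {1 5 9}/e0_ /W_rep !sl2c_mapE //.
rewrite /tnth /= /W_act1 /W_act2 /W_act3 /= natr_pred e_pred.
rewrite !mul1r; split.
- by congr (_ *: (_ - _)); apply: up0.
- by congr (_ *: (_ + _)); apply: up0.
congr (_ *: _).
rewrite /chain_eigenvalue exprS -[i.*2.+1]addn1 -[i.+1]addn1.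
by rewrite -!mul2n !(natrD, natrM); ring.
Qed.

(** The parameters of a ladder determine the action of all three generators on its vectors, so the
    map from one basis to the other intertwines. *)
Lemma rep_ladder_iso (V : vectType K) n (rho : 'Hom(sl2c K, 'End(V)))
    (sigma : 'Hom(sl2c K, 'End('rV[K]_n))) eps N t e :
    basis_of {:V} (mkseq e n) -> rep_ladder rho n eps N t e ->
    rep_ladder sigma n eps N t (e0_ n) ->
  rep_iso rho sigma.
Proof.
move=> e_basis rhoP sigmaP; apply: (rep_iso_basis e_basis).
set g := linext _; have gu j : (j < n)%N -> g (e0_ n j) = e j.
  by move=> jn; rewrite -(e0_delta (Ordinal jn)) /g linext_delta.
have g_up j : (j < n)%N ->
    g (if (j.+1 < n)%N then (N - j.+1%:R) *: e0_ n j.+1 else t *: e0_ n j)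
    = if (j.+1 < n)%N then (N - j.+1%:R) *: e j.+1 else t *: e j.
  by move=> jn; case: ltnP => [j1n|_]; rewrite linearZ /= gu.
have g_pred j : (j < n)%N -> g (e0_ n j.-1) = e j.-1.
  by move=> jn; rewrite gu // (leq_ltn_trans (leq_pred j)).
move=> i j; rewrite e0_delta.
have [rA rB rC] := rhoP _ (ltn_ord j); have [sA sB sC] := sigmaP _ (ltn_ord j).
case: (ord3P i).
- by move->; rewrite rA sA linearZ /= linearB linearZ /= g_up ?g_pred.
- by move->; rewrite rB sB linearZ /= linearD linearZ /= g_up ?g_pred.
- by move->; rewrite rC sC linearZ /= gu.
Qed.

End Ladders.

(** * Ladders on the standard basis are simple representations *)

Section Models.
Context {K : fieldType}.
Hypothesis charK0 : [pchar K] =i pred0.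

Let two0 : 2%:R != 0 :> K.
Proof. by rewrite ((pcharf0P _).1 charK0). Qed.

Lemma ladder_relations n (A B C : 'End('rV[K]_n)) eps N t e :
    (eps = 1 \/ eps = -1) -> ladder_end n N t -> ladder n eps N t A B C e ->
  forall i, (i < n)%N ->
    [/\ A (B (e i)) + B (A (e i)) = C (e i), B (C (e i)) + C (B (e i)) = A (e i)
      & C (A (e i)) + A (C (e i)) = B (e i)].
Proof.
move=> eps1 Nn ABC i im.
have lin2 (f : 'End('rV[K]_n)) a b x y : f (a *: x + b *: y) = a *: f x + b *: f y.
  by rewrite linearD !linearZ.
have lin1 (f : 'End('rV[K]_n)) a x : f (a *: x) = a *: f x by rewrite linearZ.
(* [p] and [c] give the target and the coefficient of the upward part, so that one formula also
   covers the last vector, whose upward part is a multiple of itself. *)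
pose p j := if (j.+1 < n)%N then j.+1 else j.
pose c j := if (j.+1 < n)%N then N - j.+1%:R else t.
have pm j : (j < n)%N -> (p j < n)%N by rewrite /p; case: ifP.
have mm j : (j < n)%N -> (j.-1 < n)%N by move=> jn; lia.
have eA j : (j < n)%N -> A (e j) = (eps * ((-1) ^+ j / 2%:R) * c j) *: e (p j)
    + (- (eps * ((-1) ^+ j / 2%:R) * j%:R)) *: e j.-1.
  move=> jn; have [-> _ _] := ABC j jn.
  by rewrite /c /p; case: ifP => _; rewrite scalerBr !scalerA scaleNr.
have eB j : (j < n)%N -> B (e j) = (- (1 / 2%:R) * c j) *: e (p j)
    + (- (1 / 2%:R) * j%:R) *: e j.-1.
  move=> jn; have [_ -> _] := ABC j jn.
  by rewrite /c /p; case: ifP => _; rewrite scalerDr !scalerA.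
have eC j : (j < n)%N -> C (e j) = (eps * chain_eigenvalue N j) *: e j.
  by move=> jn; have [] := ABC j jn.
rewrite !(eA, eB, eC) // !(lin1, lin2).
rewrite !(eA, eB, eC) //; try exact: pm; try exact: mm.
have sgn j : (-1) ^+ j = 1 :> K \/ (-1) ^+ j = -1 :> K.
  by rewrite -signr_odd; case: (odd j); [right|left].
have evE j : chain_eigenvalue N j = (-1) ^+ j * (2%:R * j%:R + 1 - N) / 2%:R.
  by rewrite /chain_eigenvalue -natr1 -mul2n natrM.
(* Below the last index the relations are identities in [N] and [t]; at the last index the values
   allowed by [ladder_end] are substituted. *)
have [im1|ni] := ltnP i.+1 n.
  have -> : c i = N - i.+1%:R by rewrite /c im1.
  have -> : p i = i.+1 by rewrite /p im1.
  case: i im im1 => [|j] im im1; rewrite !evE.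
    by split; apply/rowP => k; rewrite !mxE /=; case: eps1 => ->; field.
  have -> : c j = N - j.+1%:R by rewrite /c im.
  have -> : p j = j.+1 by rewrite /p im.
  rewrite !exprS -!natr1; split; apply/rowP => k; rewrite !mxE /=;
    by case: (sgn j) => ->; case: eps1 => ->; field.
have iN : n = i.+1 by lia.
have ci : c i = t by rewrite /c ltnNge ni.
have pi : p i = i by rewrite /p ltnNge ni.
rewrite !pi !ci.
have {}Nn : (N = i%:R + 1 /\ t = 0)
    \/ (N = 2%:R * (i%:R + 1) /\ (t = i%:R + 1 \/ t = - (i%:R + 1))).
  have nE : n%:R = i%:R + 1 :> K by rewrite iN natr1.
  by move: Nn; rewrite /ladder_end -mul2n natrM nE => -[[? [_ ?]]|]; [left|right].
case: i im ci pi ni iN Nn => [|j] im ci pi ni iN Nn; rewrite !evE.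
  by split; apply/rowP => k; rewrite !mxE /=; case: eps1 => ->;
    case: Nn => [[-> ->]|[-> [->|->]]]; field.
have -> : c j = N - j.+1%:R by rewrite /c im.
have -> : p j = j.+1 by rewrite /p im.
move: Nn; rewrite !exprS -!natr1 => Nn.
by split; apply/rowP => k; rewrite !mxE /=; case: (sgn j) => ->;
  case: eps1 => ->; case: Nn => [[-> ->]|[-> [->|->]]]; field.
Qed.

Lemma ladder_is_rep n (sigma : 'Hom(sl2c K, 'End('rV[K]_n))) eps N t :
    (eps = 1 \/ eps = -1) -> ladder_end n N t ->
  rep_ladder sigma n eps N t (e0_ n) -> is_rep sigma.
Proof.
move=> eps1 Nn sigmaP; have rel := ladder_relations eps1 Nn sigmaP.
apply/is_repP; split=> x; rewrite [x]row_sum_delta !linear_sum -?big_split /=;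
  apply: eq_bigr => i _; rewrite !linearZ -?scalerDr /= e0_delta;
  by have [relAB relBC relCA] := rel _ (ltn_ord i);
    rewrite ?relAB ?relBC ?relCA; congr (_ *: _); first
      [exact: relAB | exact: relBC | exact: relCA].
Qed.

(* Separates the upward from the downward part of the action on [e i]. *)
Lemma ladder_up (V : vectType K) n eps N t (A B C : V -> V) e i :
    (eps = 1 \/ eps = -1) -> ladder n eps N t A B C e -> (i < n)%N ->
  (if (i.+1 < n)%N then (N - i.+1%:R) *: e i.+1 else t *: e i)
  = (eps * (-1) ^+ i) *: A (e i) - B (e i).
Proof.
move=> eps1 ABC im; have [-> -> _] := ABC i im; set up := if _ then _ else _.
rewrite scalerA (_ : _ * _ * _ = 1 / 2%:R); last first.
  by rewrite -signr_odd; case: eps1 => ->; case: (odd i); rewrite ?expr0 ?expr1; field.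
rewrite scaleNr opprK -scalerDr addrACA addNr addr0 -mulr2n -scaler_nat.
by rewrite scalerA mulfVK // scale1r.
Qed.

(** A nonzero stable subspace contains a basis vector, because [a_3] separates the components of its
    elements. The nonzero coefficients of the steps up and down then yield all basis vectors. *)
Lemma ladder_simple n (sigma : 'Hom(sl2c K, 'End('rV[K]_n))) eps N t :
    (0 < n)%N -> (eps = 1 \/ eps = -1) -> ladder_end n N t ->
  rep_ladder sigma n eps N t (e0_ n) -> simple_rep sigma.
Proof.
move=> n0 eps1 Nn sigmaP; split; first exact: ladder_is_rep sigmaP.
  by rewrite (_ : \dim _ = n) -?lt0n // dimvf dim_matrix; apply: mul1n.
move=> U stU; have [->|U0] := eqVneq U 0%VS; [by left|right].
have stab i x : x \in U -> sigma (sl2c_a K i) x \in U.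
  by move=> xU; apply: (subvP (stU (sl2c_a K i))); apply: memv_img.
have eps0 : eps != 0 by case: eps1 => ->; rewrite ?oppr_eq0 oner_eq0.
have [k uk] : exists k : 'I_n, e0_ n k \in U.
  pose w := vpick U; pose c i := if insub i is Some k then w 0 k else 0 : K.
  have cE (k : 'I_n) : c k = w 0 k by rewrite /c valK.
  have wU : \sum_(i < n) c i *: e0_ n i \in U.
    suff <- : w = \sum_(i < n) c i *: e0_ n i by apply: memv_pick.
    by rewrite [w]row_sum_delta; apply: eq_bigr => i _; rewrite cE e0_delta.
  have /rV0Pn[k wk] : w != 0 by rewrite vpick0.
  exists k; have := rpredZeq U (w 0 k) (e0_ n k); rewrite (negPf wk) /= => <-.
  rewrite -cE.
  apply: (@eigenvector_components _ _ (sigma (sl2c_a K 2%:R)) U n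
    (fun i => eps * chain_eigenvalue N i) (fun i => c i *: e0_ n i)) => //.
  - move=> i j ij; rewrite (inj_eq (mulfI eps0)).
    exact: (ladder_eigenvalue_neq charK0 Nn).
  - by move=> i im; have [_ _ e] := sigmaP i im; rewrite linearZ /= e !scalerA mulrC.
  - exact: stab.
have upU i : (i.+1 < n)%N -> e0_ n i \in U -> e0_ n i.+1 \in U.
  move=> im iU; have := rpredZeq U (N - i.+1%:R) (e0_ n i.+1).
  rewrite (negPf (ladder_coef_neq0 charK0 Nn im)) /= => <-.
  have := ladder_up eps1 sigmaP (ltnW im); rewrite im => ->.
  by rewrite memvB ?memvZ // stab.
have downU i : (i.+1 < n)%N -> e0_ n i.+1 \in U -> e0_ n i \in U.
  move=> im iU; have := rpredZeq U i.+1%:R (e0_ n i).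
  rewrite ((pcharf0P _).1 charK0) /= => <-.
  have [_ eB _] := sigmaP _ im; have := stab 1 _ iU.
  rewrite eB rpredZeq oppr_eq0 mulf_eq0 oner_eq0 invr_eq0 (negPf two0) /=.
  by rewrite (ladder_up eps1 sigmaP im) rpredDl // memvB ?memvZ // stab.
have u0U : e0_ n 0 \in U.
  case: k uk => /= k kn; elim: k kn => // k IHk kn /(downU _ kn).
  exact: IHk (ltnW kn).
have uU i : (i < n)%N -> e0_ n i \in U.
  by elim: i => // i IHi im; apply: upU => //; apply/IHi/ltnW.
apply/vspaceP => x; rewrite memvf [x]row_sum_delta; apply: memv_suml => i _.
by rewrite memvZ // e0_delta uU.
Qed.

Lemma ladder_eigenvector n (sigma : 'Hom(sl2c K, 'End('rV[K]_n))) eps N t a w :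
    rep_ladder sigma n eps N t (e0_ n) -> sigma (sl2c_a K 2%:R) w = a *: w ->
  forall k : 'I_n, w 0 k != 0 -> eps * chain_eigenvalue N k = a.
Proof.
move=> sigmaP w_a k wk; apply: (mulIf wk).
have -> : a * w 0 k = (a *: w) 0 k by rewrite mxE.
rewrite -w_a {2}[w]row_sum_delta linear_sum summxE (bigD1 k) //=.
rewrite big1 ?addr0 => [|i ik]; rewrite linearZ /= e0_delta.
  by have [_ _ ->] := sigmaP _ (ltn_ord k); rewrite !mxE eqxx mulr1 mulrC.
have [_ _ ->] := sigmaP _ (ltn_ord i); rewrite !mxE eqSS.
by rewrite (_ : (k == i :> nat) = false) ?mulr0 //; apply/negbTE; rewrite eq_sym.
Qed.

End Models.

(** * Isomorphism classes of simple representations *)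

Section Classification.
Context {K : closedFieldType}.
Hypothesis charK0 : [pchar K] =i pred0.

Definition sign (x : K) : Prop := x = 1 \/ x = -1.

Let two0 : 2%:R != 0 :> K.
Proof. by rewrite ((pcharf0P _).1 charK0). Qed.

Let sign_exp i : sign ((-1) ^+ i).
Proof. by rewrite -signr_odd; case: (odd i); [right|left]. Qed.

Let signM x y : sign x -> sign y -> sign (x * y).
Proof.
by case=> -> [] ->; rewrite /sign ?mulN1r ?mul1r ?opprK; [left|right|right|left].
Qed.

Let sign_sqr x : sign x -> x * x = 1.
Proof. by case=> ->; rewrite ?mulrNN mul1r. Qed.

Let sign_nat x y p : sign x -> sign y -> x * p%:R = y -> p = 1%N /\ x = y.
Proof.
move=> sx sy xy; have px : p%:R = x * y by rewrite -xy mulrA sign_sqr ?mul1r.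
have [xy1|xyN] := signM sx sy.
  have p1 : p = 1%N by apply/eqP; rewrite -(eqr_nat_char0 charK0) px xy1.
  by split=> //; rewrite -xy p1 mulr1.
have /eqP := xyN; rewrite -px -addr_eq0 -(natrD _ p 1) ((pcharf0P _).1 charK0).
by rewrite addn1.
Qed.

Let V_end n a2 : sign a2 -> ladder_end n n.*2%:R (a2 * n%:R).
Proof. by case=> ->; right; split; rewrite // ?mul1r ?mulN1r; [left|right]. Qed.

Lemma V_rep_simple n (alpha : K * K) :
  (0 < n)%N -> sign alpha.1 -> sign alpha.2 -> simple_rep (V_rep n alpha).
Proof.
move=> n0 s1 s2.
exact: (ladder_simple charK0 n0 s1 (V_end n s2) (V_rep_ladder (n:=n) alpha)).
Qed.

Lemma W_rep_simple n : odd n -> simple_rep (W_rep n : 'Hom(sl2c K, _)).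
Proof.
move=> n_odd; apply: (ladder_simple charK0 _ _ _ (W_rep_ladder (n:=n))).
- by case: n n_odd.
- by left.
- by left.
Qed.

(* The image of the last basis vector, of weight [+-1/2]. *)
Lemma V_rep_iso_last n (alpha : K * K) (V : vectType K)
    (sigma : 'Hom(sl2c K, 'End(V))) :
    sign alpha.1 -> rep_iso (V_rep n.+1 alpha) sigma ->
  exists w, [/\ w != 0,
    sigma (sl2c_a K 2%:R) w = (- (alpha.1 * (-1) ^+ n) / 2%:R) *: w &
    (alpha.1 * (-1) ^+ n) *: sigma (sl2c_a K 0) w - sigma (sl2c_a K 1) w
      = (alpha.2 * n.+1%:R) *: w].
Proof.
move=> s1 [f f_bij f_rho]; exists (f (e0_ n.+1 n)).
have f_inj := bij_inj f_bij; have VP := V_rep_ladder (n:=n.+1) alpha.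
split.
- rewrite -(linear0 f) (inj_eq f_inj); apply/eqP => /rowP/(_ ord_max).
  by rewrite !mxE eqxx => /eqP; rewrite oner_eq0.
- have [_ _ e] := VP n (ltnSn n); rewrite -f_rho e linearZ /=; congr (_ *: _).
  rewrite /chain_eigenvalue doubleS -[n.*2.+2]addn1 natrD.
  by field.
have /= := ladder_up charK0 s1 VP (ltnSn n).
rewrite ltnn => /(congr1 f).
by rewrite linearB !linearZ /= !f_rho => <-.
Qed.

(** On [V_rep n beta] the eigenvalue of [a_3] at [k], counted from 0, is [+-(2 (n - k) - 1) / 2],
    hence [+-1/2] only at the last index. So the last basis vector goes to a multiple of the last
    one; its eigenvalue fixes [alpha.1], its upward part [alpha.2]. *)
Lemma V_rep_inj n (alpha beta : K * K) :
    (0 < n)%N -> sign alpha.1 -> sign beta.1 ->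
  rep_iso (V_rep n alpha) (V_rep n beta) -> alpha = beta.
Proof.
case: n => // n _ s1 t1 /(V_rep_iso_last s1)[w [w0 Cw w_up]].
have VP := V_rep_ladder (n:=n.+1) beta.
have wk (k : 'I_n.+1) : w 0 k != 0 -> k = ord_max /\ alpha.1 = beta.1.
  move=> /(ladder_eigenvector VP Cw) e.
  have [] := @sign_nat (beta.1 * (-1) ^+ k) (alpha.1 * (-1) ^+ n) (n - k).*2.+1.
  - exact: signM.
  - exact: signM.
  - apply: (mulIf (invr_neq0 two0)); rewrite -[RHS]opprK -mulNr -e.
    rewrite /chain_eigenvalue; have kn := leq_ord k.
    have -> : (n - k).*2.+1%:R = n.+1.*2%:R - k.*2.+1%:R :> K.
      by rewrite -natrB; [congr (_%:R)|]; lia.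
    by field.
  move=> nk e1; have kn : k = ord_max by apply: val_inj => /=; have := ltn_ord k; lia.
  split=> //; move: e1; rewrite kn /= => /esym; apply: mulIf.
  by rewrite signr_eq0.
have [k wk0] := rV0Pn _ w0; have [_ e1] := wk k wk0.
have wE : w = w 0 ord_max *: e0_ n.+1 n.
  rewrite {1}[w]row_sum_delta (bigD1 ord_max) //= e0_delta big1 ?addr0 // => i ni.
  have [->|/wk[]] := eqVneq (w 0 i) 0; first by rewrite scale0r.
  by move=> ei; rewrite ei eqxx in ni.
have /= := ladder_up charK0 t1 VP (ltnSn n).
rewrite ltnn -e1 => u_up; move: w_up; rewrite wE !linearZ /= -scalerDr.
rewrite -u_up !scalerA => /eqP.
rewrite -subr_eq0 -scalerBl scaler_eq0 => /orP[|/eqP u0]; last first.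
  by move/eqP: w0; rewrite wE u0 scaler0.
rewrite -mulrBr mulf_eq0 -mulrBl mulf_eq0.
rewrite ((pcharf0P _).1 charK0) orbF => /orP[/eqP w00|].
  by move/eqP: w0; rewrite wE w00 scale0r.
rewrite subr_eq0 => /eqP/esym e2; case: alpha beta e1 e2 {VP wk Cw u_up s1 t1}.
by move=> a1 a2 [b1 b2] /= -> ->.
Qed.

(** For odd [n] the eigenvalues of [a_3] on [W_rep n] are integers, while [V_rep n alpha] has an
    eigenvalue [+-1/2]. *)
Lemma V_rep_not_iso_W n (alpha : K * K) : odd n -> sign alpha.1 ->
  ~ rep_iso (V_rep n alpha) (W_rep n).
Proof.
case: n => // n n_odd s1 /(V_rep_iso_last s1)[w [w0 Cw _]].
have [k /(ladder_eigenvector (W_rep_ladder (n:=n.+1)) Cw) e] := rV0Pn _ w0.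
have {e}e : (-1) ^+ k * (k.*2.+1%:R - n.+1%:R) = - (alpha.1 * (-1) ^+ n).
  by apply: (mulIf (invr_neq0 two0)); rewrite -e mul1r.
have sn : sign (alpha.1 * (-1) ^+ n) by apply: signM.
have signN x : sign x -> sign (- x) by case=> ->; rewrite /sign ?opprK; [right|left].
(* In either order the difference is an even natural number, which [sign_nat] would force to be
   [1]. *)
have [le|/ltnW le] := leqP n.+1 k.*2.+1.
  rewrite -natrB // in e.
  by have [/eqP] := sign_nat (sign_exp k) (signN _ sn) e; lia.
have {e}e : (-1) ^+ k * (n.+1 - k.*2.+1)%N%:R = alpha.1 * (-1) ^+ n.
  by rewrite natrB // -[RHS]opprK -e -mulrN opprB.
by have [/eqP] := sign_nat (sign_exp k) sn e; lia.
Qed.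

(* [W^n] is fixed by the twist [a_1, a_3 |-> - a_1, - a_3]. *)
Lemma ladder_rev (V : vectType K) n eps (A B C : V -> V) e :
    odd n -> ladder n eps n%:R 0 A B C e ->
  ladder n (- eps) n%:R 0 A B C (fun i => e (n.-1 - i)%N).
Proof.
move=> n_odd ABC i im.
have up0 j : (j < n)%N ->
    (if (j.+1 < n)%N then (n%:R - j.+1%:R) *: e j.+1 else 0 *: e j)
    = (n%:R - j.+1%:R) *: e j.+1.
  move=> jn; case: ltnP => // nj; rewrite (_ : j.+1 = n); last by lia.
  by rewrite subrr !scale0r.
(* Reversal exchanges the upward part at [k] with the downward part at [i], and conversely. *)
pose k := (n.-1 - i)%N; have kn : (k < n)%N by rewrite /k; lia.
have k_nat : k%:R = n%:R - i.+1%:R :> K.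
  by rewrite -natrB // /k; congr (_%:R); lia.
have i_nat : n%:R - k.+1%:R = i%:R :> K.
  by rewrite -natrB // /k; congr (_%:R); lia.
have up : (if (i.+1 < n)%N then (n%:R - i.+1%:R) *: e (n.-1 - i.+1)%N
             else 0 *: e (n.-1 - i)%N) = k%:R *: e k.-1.
  rewrite k_nat; case: ltnP => [i1n|ni].
    by congr (_ *: e _); rewrite /k; lia.
  by rewrite (_ : i.+1 = n) ?subrr ?scale0r //; lia.
have down : (n%:R - k.+1%:R) *: e k.+1 = i%:R *: e (n.-1 - i.-1)%N.
  rewrite i_nat; case: i im @k kn k_nat i_nat up => [|i] im k *.
    by rewrite !scale0r.
  by congr (_ *: e _); rewrite /k /=; lia.
have sgn : (-1) ^+ k = (-1) ^+ i :> K.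
  by rewrite -signr_odd -[RHS]signr_odd; congr (_ ^+ _); rewrite /k; lia.
have [eA eB eC] := ABC k kn; move: eA eB; rewrite up0 // down => eA eB.
rewrite /= -/k up; split.
- by rewrite eA sgn mulNr scaleNr -[RHS]scalerN opprB.
- by rewrite eB addrC.
rewrite eC; congr (_ *: _); rewrite /chain_eigenvalue sgn mulNr -mulrN; congr (_ * _).
have h : k.*2.+1%:R + i.*2.+1%:R = n%:R + n%:R :> K.
  by rewrite -!natrD; congr (_%:R); rewrite /k; lia.
by rewrite -[k.*2.+1%:R](addrK i.*2.+1%:R) h; field.
Qed.

(** [lowest_weight_basis] is applied to [rho] or to its twist by [eps = -1]; undoing the twist gives
    a ladder for [rho] itself with this [eps]. *)
Lemma simple_rep_classification (V : vectType K) (rho : 'Hom(sl2c K, 'End(V))) :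
    simple_rep rho -> let n := \dim {:V} in
  (exists a1 a2, [/\ sign a1, sign a2 & rep_iso rho (V_rep n (a1, a2))])
    \/ (odd n /\ rep_iso rho (W_rep n)).
Proof.
case=> /is_repP[relAB relBC relCA] n0 rho_simple n.
pose A eps := eps *: rho (sl2c_a K 0); pose C eps := eps *: rho (sl2c_a K 2%:R).
pose B := rho (sl2c_a K 1).
have [mu [/leigenvalueP[x x0 Cx] mu_refl]] :=
  eigenvalue_missing_reflection (rho (sl2c_a K 2%:R)) charK0 n0.
have [eps [nu [s Cy no_refl]]] : exists eps nu, [/\ sign eps, C eps x = nu *: x &
    forall y, C eps y = (1 - nu) *: y -> y = 0].
  have no_eig a y : ~~ passmx.leigenvalue (rho (sl2c_a K 2%:R)) a ->
      rho (sl2c_a K 2%:R) y = a *: y -> y = 0.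
    by move=> /leigenvalueP no_a ya; apply/eqP/negPn/negP => y0; apply: no_a; exists y.
  (* If [- 1 - mu] is not an eigenvalue of [a_3], then its opposite [1 - nu], for [nu = - mu], is
     not one of [- a_3]. *)
  case: mu_refl => no_mu; [exists 1, mu|exists (-1), (- mu)]; split.
  - by left.
  - by rewrite /C scale1r.
  - by move=> y; rewrite /C scale1r; apply: no_eig.
  - by right.
  - by rewrite /C scaleN1r opp_lfunE Cx scaleNr.
  move=> y; rewrite /C scaleN1r opp_lfunE => /eqP.
  rewrite eqr_oppLR => /eqP e; apply: (no_eig _ _ no_mu); rewrite e -scaleNr.
  by congr (_ *: _); ring.
have AE y : rho (sl2c_a K 0) y = eps *: A eps y.
  by rewrite /A scale_lfunE scalerA sign_sqr // scale1r.
have CE y : rho (sl2c_a K 2%:R) y = eps *: C eps y.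
  by rewrite /C scale_lfunE scalerA sign_sqr // scale1r.
have [||||e [N [t [e_basis Nt]]]] := @lowest_weight_basis _ _ (A eps) B (C eps)
  charK0 _ _ _ _ nu x x0 Cy no_refl.
- by move=> y /=; rewrite /A /C !scale_lfunE linearZ -scalerDr relAB.
- by move=> y /=; rewrite /A /C !scale_lfunE linearZ -scalerDr relBC.
- move=> y /=; rewrite /A /C !scale_lfunE !linearZ /= -!scalerDr relCA.
  by rewrite scalerA sign_sqr // scale1r.
- move=> U AU BU CU; apply: rho_simple; apply: sl2c_stable => i y yU.
  case: (ord3P i) => ->; last by rewrite CE memvZ // CU.
    by rewrite AE memvZ // AU.
  exact: BU.
move=> ABC.
have rhoP : rep_ladder rho n eps N t e.
  move=> i im; have [eA eB eC] := ABC i im; split.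
  - by rewrite AE eA scalerA mul1r.
  - exact: eB.
  - by rewrite CE eC scalerA mul1r.
case: Nt => [[NE [n_odd t0]]|[NE tE]].
  right; split=> //; rewrite NE t0 in rhoP.
  (* For [eps = -1], reversing the basis restores the sign, so both twists give the same
     [W_rep n]. *)
  case: s rhoP => -> rhoP.
    exact: (rep_ladder_iso e_basis rhoP (W_rep_ladder (n:=n))).
  have := ladder_rev n_odd rhoP; rewrite opprK => revP.
  apply: (rep_ladder_iso _ revP (W_rep_ladder (n:=n))).
  rewrite (_ : mkseq _ n = rev (mkseq e n)).
    by rewrite (perm_basis _ (_ : perm_eq _ (mkseq e n))) // perm_rev.
  apply: (@eq_from_nth _ 0) => [|i]; rewrite ?size_rev !size_mkseq // => im.
  rewrite nth_rev !size_mkseq // !nth_mkseq //; last by lia.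
  by congr e; lia.
left; rewrite NE in rhoP.
case: tE => tE; [exists eps, 1|exists eps, (-1)]; split=> //; [by left| |by right|];
  rewrite tE in rhoP; apply: (rep_ladder_iso e_basis rhoP).
- by have := V_rep_ladder (n:=n) (eps, 1); rewrite mul1r.
- by have := V_rep_ladder (n:=n) (eps, -1); rewrite mulN1r.
Qed.

End Classification.

Theorem theorem5p2 (K : closedFieldType) (charK0 : [pchar K] =i pred0)
    (n : nat) (n_ge1 : (1 <= n)%N) :
  (~~ odd n ->
     exactly_simple_reps
       [tuple V_rep n (1 : K, 1 : K); V_rep n (1 : K, - 1 : K);
              V_rep n (- 1 : K, 1 : K); V_rep n (- 1 : K, - 1 : K)])
  /\
  (odd n ->
     exactly_simple_reps
       [tuple V_rep n (1 : K, 1 : K); V_rep n (1 : K, - 1 : K);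
              V_rep n (- 1 : K, 1 : K); V_rep n (- 1 : K, - 1 : K);
              W_rep n]).
Proof.
have s1 : sign (1 : K) by left.
have sN : sign (-1 : K) by right.
have simpleV a1 a2 : sign a1 -> sign a2 -> simple_rep (V_rep n (a1 : K, a2 : K)).
  by move=> *; apply: V_rep_simple.
(* Two different sign pairs differ as [1] and [-1] in some coordinate, so this separates the four
   parameters. *)
have one_neqN : (1 : K) <> -1.
  move=> e; have := eqr_nat_char0 charK0 2 0.
  by rewrite mulr2n {2}e subrr eqxx.
have Vneq (a b : K * K) : sign a.1 -> sign b.1 -> a <> b ->
    ~ rep_iso (V_rep n a) (V_rep n b).
  by move=> sa sb ab /(V_rep_inj charK0 n_ge1 sa sb).
have dimP (V : vectType K) (rho : 'Hom(sl2c K, 'End(V))) : \dim {:V} = n ->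
    simple_rep rho ->
    [\/ rep_iso rho (V_rep n (1 : K, 1 : K)), rep_iso rho (V_rep n (1 : K, -1 : K)),
        rep_iso rho (V_rep n (-1 : K, 1 : K)) | rep_iso rho (V_rep n (-1 : K, -1 : K))]
    \/ (odd n /\ rep_iso rho (W_rep n)).
  move=> <- /(simple_rep_classification charK0) [|]; last by right.
  case=> a1 [a2 [[->|->] [->|->] iso]]; left;
    [constructor 1|constructor 2|constructor 3|constructor 4]; exact: iso.
split=> n_par; split.
- by case=> [[|[|[|[|//]]]] p]; apply: simpleV.
- case=> [[|[|[|[|//]]]] p] [[|[|[|[|//]]]] q] //= _;
    apply: Vneq => //= -[]; by [|move/esym].
- move=> V rho dimV /(dimP _ _ dimV) [[] iso|[]]; last by rewrite (negPf n_par).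
  + by exists (inord 0); rewrite /tnth inordK.
  + by exists (inord 1); rewrite /tnth inordK.
  + by exists (inord 2); rewrite /tnth inordK.
  + by exists (inord 3); rewrite /tnth inordK.
- by case=> [[|[|[|[|[|//]]]]] p]; [| | | |exact: W_rep_simple]; apply: simpleV.
- have VW a : sign a.1 -> ~ rep_iso (V_rep n (a : K * K)) (W_rep n).
    exact: V_rep_not_iso_W.
  have WV a : sign a.1 -> ~ rep_iso (W_rep n) (V_rep n (a : K * K)).
    by move=> sa /rep_iso_sym; apply: VW.
  (* The last row and the last column of pairs involve [W_rep n]; the others compare two sign
     pairs. *)
  (case=> [[|[|[|[|[|//]]]]] p];
    last by case=> [[|[|[|[|[|//]]]]] q] //= _; apply: WV);
    (case=> [[|[|[|[|[|//]]]]] q] //= _; last exact: VW);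
    by apply: Vneq => //= -[]; by [|move/esym].
- move=> V rho dimV /(dimP _ _ dimV) [[] iso|[_ iso]].
  + by exists (inord 0); rewrite /tnth inordK.
  + by exists (inord 1); rewrite /tnth inordK.
  + by exists (inord 2); rewrite /tnth inordK.
  + by exists (inord 3); rewrite /tnth inordK.
  + by exists (inord 4); rewrite /tnth inordK.
Qed.
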